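(* Let $r\ge 2$ and let $\lambda=(a_1,\dots,a_r)$ be integers with $a_1>a_2>\cdots>a_{r-1}>a_r=0$. Put $d(\lambda)=\gcd(a_1,\dots,a_r)$ and $\rho=(r-1,r-2,\dots,1,0)$. For a tuple $\mu=(b_1,\dots,b_r)$ of non-negative integers let $S(\mu)=\det\big(x_i^{b_j}\big)_{1\le i,j\le r}\in\mathbb{C}[x_1,\dots,x_r]$, and for a positive integer $d$ write $d\rho=(d(r-1),d(r-2),\dots,d,0)$. If $\lambda\neq d(\lambda)\rho$, then the polynomial $C(\lambda)=S(\lambda)/S(d(\lambda)\rho)$ (which is a symmetric polynomial) is irreducible in the ring $\mathbb{C}[x_1,\dots,x_r]$.
   Context: $S(d\rho)=\prod_{i<j}(x_i^d-x_j^d)$ divides $S(\lambda)$ when $d\mid d(\lambda)$, so $C(\lambda)$ is a polynomial. Irreducible means: not a unit and not a product of two non-units. *)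

(* Defs.v *)
From mathcomp Require Import all_boot all_algebra.
From mathcomp Require Import mpoly.
From mathcomp Require Import complex.
From mathcomp Require Import Rstruct.
Set Implicit Arguments. Unset Strict Implicit. Unset Printing Implicit Defensive.
Import GRing.Theory.
Local Open Scope ring_scope.

Definition CC : closedFieldType := complex Rdefinitions.R.

Definition Sdet (r : nat) (mu : 'I_r -> nat) : {mpoly CC[r]} :=
  \det (\matrix_(i < r, j < r) ('X_i ^+ mu j : {mpoly CC[r]})).

Definition dlam (r : nat) (lam : 'I_r -> nat) : nat := \big[gcdn/0%N]_(i < r) lam i.

Definition drho (r : nat) (d : nat) : 'I_r -> nat := fun j => (d * (r.-1 - j))%N.

Definition irreducible_elt (R : comUnitRingType) (p : R) : Prop :=
  p \isn't a GRing.unit /\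
  ~ (exists a b : R, [/\ a \isn't a GRing.unit, b \isn't a GRing.unit & p = a * b]).

(* Main.v *)
(* Dividing the exponents by their gcd [d], [C] is [C1(x_1^d, ..., x_r^d)] with [C1] the quotient
   of an alternant [S(e)] by the Vandermonde determinant, of degree [N = e_1 - (r - 1)] in each
   variable.  The bracket [D(s, t) = (s^d - t^d) C(s, w, t)], as the determinant of a matrix with
   only two varying rows up to factors in one variable, satisfies the three-term Pluecker relation.

   A sparse polynomial with exponents [e] and a double root at 1 as its only multiple root yields
   a point where [C(1, 1, kappa, t)] is separable in [t].  Since exchanging the first two
   variables fixes that line, every irreducible factor of [C] involves all the variables and is
   symmetric up to a scalar.
   If [C = f g] and [N > 1], then on a generic line there are a root [t] of [f] and a root [y] of
   [g] with [t^d <> y^d], since [C(x, w, .)] has [d N > d] simple roots.  The Pluecker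
   relation makes [C(y, w, t)] vanish, so [f(y, w, t) = 0] or [g(y, w, t) = 0], and either puts the
   hypersurface of one factor inside the zero set of a resultant of [f] and [g]; this is impossible,
   as [C(x, w, .)] is separable at some point [(x, w, x)] of that hypersurface.

   If [N = 1], then [C1] is up to a scalar an elementary symmetric polynomial.  Setting the middle
   variables to a [d]-th root of -1 gives [(p X^d + q) Y^d + (q X^d + t)] with binomial
   coefficients [p], [-q], [t]; as [p t <> q^2], Eisenstein's criterion applies. *)

Require Import Defs.
From HB Require Import structures.
From Stdlib Require Import Classical FunctionalExtensionality.
From mathcomp Require Import all_boot all_algebra all_fingroup.
From mathcomp Require Import mpoly complex ring zify.
Set Implicit Arguments. Unset Strict Implicit. Unset Printing Implicit Defensive.
Import GRing.Theory.
Local Open Scope ring_scope.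

(** * Unique factorization *)

Definition divides (R : comNzRingType) (a b : R) : Prop := exists c, b = a * c.

Definition prime_elt (R : comNzRingType) (p : R) : Prop :=
  forall a b, divides p (a * b) -> divides p a \/ divides p b.

Record is_ufd (R : idomainType) : Prop := IsUfd {
  ufd_prime : forall p : R, irreducible_elt p -> prime_elt p;
  ufd_acc : exists mu : R -> nat, forall a b : R, a * b != 0 ->
    (mu a <= mu (a * b)%R)%N /\
    (b \isn't a GRing.unit -> (mu a < mu (a * b)%R)%N) }.

Section Divides.
Variable R : idomainType.
Implicit Types a b c p : R.

Lemma divides_trans a b c : divides a b -> divides b c -> divides a c.
Proof. by move=> [x ->] [y ->]; exists (x * y); rewrite mulrA. Qed.

Lemma divides_mulr a b c : divides a b -> divides a (b * c).
Proof. by move=> [x ->]; exists (x * c); rewrite mulrA. Qed.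

Lemma divides_mull a b c : divides a b -> divides a (c * b).
Proof. by rewrite mulrC; apply: divides_mulr. Qed.

Lemma dividesD a b c : divides a b -> divides a c -> divides a (b + c).
Proof. by move=> [x ->] [y ->]; exists (x + y); rewrite mulrDr. Qed.

Lemma dividesB a b c : divides a b -> divides a c -> divides a (b - c).
Proof. by move=> [x ->] [y ->]; exists (x - y); rewrite mulrBr. Qed.

Lemma divides0 a : divides a 0.
Proof. by exists 0; rewrite mulr0. Qed.

Lemma irreducible_neq0 p : irreducible_elt p -> p != 0.
Proof.
case=> _ Hp; apply/eqP => p0; apply: Hp; exists 0, 0.
by rewrite unitr0 p0 mulr0.
Qed.

Lemma irreducible_divides p a b :
  irreducible_elt p -> p = a * b -> a \is a GRing.unit \/ b \is a GRing.unit.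
Proof.
move=> [_ Hp] e; case: (boolP (a \is a GRing.unit)) => [|Ha]; first by left.
case: (boolP (b \is a GRing.unit)) => [|Hb]; first by right.
by case: Hp; exists a, b.
Qed.

Lemma irreducible_factor_ind (P : R -> Prop) : is_ufd R ->
  (forall u, u \is a GRing.unit -> P u) ->
  (forall p a, irreducible_elt p -> P a -> P (p * a)) ->
  forall a, a != 0 -> P a.
Proof.
move=> [_ [mu Hmu]] Pu Pp a a0.
have [m] := ubnP (mu a); elim: m => // m IH in a a0 *; rewrite ltnS => le_m.
case: (boolP (a \is a GRing.unit)) => [/Pu //|nu].
suff [p [b [irr_p eab]]] : exists p b, irreducible_elt p /\ a = p * b.
  have b0 : b != 0 by apply: contraNneq a0 => b0; rewrite eab b0 mulr0.
  rewrite eab; apply: Pp => //; apply: IH => //; apply: leq_trans le_m.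
  rewrite eab mulrC; apply: (proj2 (Hmu b p _)); last by case: irr_p.
  by rewrite mulrC -eab.
have [k] := ubnP (mu a); elim: k => // k IHk in a a0 nu {IH le_m} *.
rewrite ltnS => le_k.
case: (classic (irreducible_elt a)) => [irr|nirr].
  by exists a, 1; rewrite mulr1.
have [x [y [nx ny exy]]] : exists x y : R,
    [/\ x \isn't a GRing.unit, y \isn't a GRing.unit & a = x * y].
  by apply: NNPP => H; apply: nirr.
have x0 : x != 0 by apply: contraNneq a0 => x0; rewrite exy x0 mul0r.
have [|p [b [irr ep]]] := IHk x x0 nx.
  apply: leq_trans le_k; rewrite exy; apply: (proj2 (Hmu x y _)) => //.
  by rewrite -exy.
by exists p, (b * y); rewrite exy ep mulrA.
Qed.

Lemma irreducible_factor a : is_ufd R -> a != 0 -> a \isn't a GRing.unit ->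
  exists p, irreducible_elt p /\ divides p a.
Proof.
move=> HR a0 nu; elim/irreducible_factor_ind: a / a0 nu => // [u ->//|].
by move=> p a irr _ _; exists p; split => //; exists a.
Qed.

Lemma irreducible_associate p q : irreducible_elt p -> q \isn't a GRing.unit ->
  divides q p -> exists2 u, u \is a GRing.unit & p = u * q.
Proof.
move=> irr nq [c e]; case: (irreducible_divides irr e) => [|uc].
  by rewrite (negbTE nq).
by exists c; rewrite // mulrC.
Qed.

End Divides.

(** * Gauss's lemma *)

Section Gauss.
Variable R : idomainType.
Hypothesis HR : is_ufd R.
Implicit Types (f g h : {poly R}) (c : R).

Lemma unit_polyC c : (c%:P \is a GRing.unit) = (c \is a GRing.unit).
Proof.
rewrite poly_unitE coefC eqxx size_polyC.
by have [->|_] := eqVneq c 0; rewrite ?unitr0.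
Qed.

Lemma size1_polyCP f : size f = 1%N -> exists2 c, c != 0 & f = c%:P.
Proof. by move/eqP/size_poly1P. Qed.

Lemma divides_polyC c f : divides c%:P f <-> forall i, divides c f`_i.
Proof.
split=> [[g ->] i|H]; first by exists g`_i; rewrite coefCM.
elim/poly_ind: f H => [_|f b IH H]; first exact: divides0.
apply: dividesD.
  apply: divides_mulr; apply: IH => i.
  by have := H i.+1; rewrite coefD coefMX coefC /= addr0.
have := H 0%N; rewrite coefD coefMX coefC /= add0r => -[x ->].
by exists x%:P; rewrite polyCM.
Qed.

Lemma irreducible_polyC c : irreducible_elt c%:P -> irreducible_elt c.
Proof.
move=> [nu H]; split; first by rewrite unit_polyC in nu.
move=> [a [b [na nb e]]]; apply: H; exists a%:P, b%:P.
by rewrite !unit_polyC e polyCM.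
Qed.

Lemma prime_polyC c : prime_elt c -> prime_elt c%:P.
Proof.
move=> pc f g; have [m] := ubnP (size f + size g).
elim: m => // m IH in f g *; rewrite ltnS => le_m dv.
have [->|f0] := eqVneq f 0; first by left; apply: divides0.
have [->|g0] := eqVneq g 0; first by right; apply: divides0.
have : divides c (lead_coef f * lead_coef g).
  by rewrite -lead_coefM lead_coefE; apply: (proj1 (divides_polyC _ _) dv).
(* Removing a leading term divisible by [c] keeps the product divisible. *)
have red f' g' : f' != 0 -> divides c (lead_coef f') -> divides c%:P (f' * g') ->
  exists2 f1 : {poly R}, (size f1 < size f')%N & divides c%:P (f1 * g') /\
    (divides c%:P f1 -> divides c%:P f').
  move=> f'0 dl dfg; set t := lead_coef f' *: 'X^((size f').-1).
  have dt : divides c%:P t.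
    by case: dl => x ex; exists (x *: 'X^((size f').-1));
      rewrite /t ex -!mul_polyC polyCM mulrA.
  exists (f' - t).
    have lt0 : (size f' > 0)%N by rewrite size_poly_gt0.
    rewrite -(prednK lt0) ltnS; apply/leq_sizeP => j le_j.
    rewrite coefB coefZ coefXn; have [->|ne] := eqVneq j (size f').-1.
      by rewrite mulr1 -lead_coefE subrr.
    rewrite mulr0 subr0 nth_default //; move: le_j ne lt0.
    by case: (size f') => //= k; rewrite leq_eqVlt eq_sym => /orP[->|].
  split; first by rewrite mulrBl; apply: dividesB => //; apply: divides_mulr.
  by move=> d1; rewrite -(subrK t f'); apply: dividesD.
case/pc => dl.
  have [f1 lt1 [d1 back]] := red f g f0 dl dv.
  case: (IH f1 g) => //; first by apply: leq_trans le_m; rewrite ltn_add2r.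
  by move/back; left.
  by right.
rewrite mulrC in dv; have [g1 lt1 [d1 back]] := red g f g0 dl dv.
rewrite mulrC in d1; case: (IH f g1) => //.
- by apply: leq_trans le_m; rewrite ltn_add2l.
- by left.
- by move/back; right.
Qed.

Lemma divides_cancel_polyC f g c : irreducible_elt f -> (1 < size f)%N ->
  c != 0 -> divides f (c%:P * g) -> divides f g.
Proof.
move=> irr szf c0; elim/irreducible_factor_ind: c / c0 g => [//|u uu g [q e]|].
  exists (u^-1%:P * q).
  by rewrite mulrCA -e mulrA -polyCM mulVr // mul1r.
move=> p a irrp IH g [q e]; apply: IH.
have pp := prime_polyC (ufd_prime HR irrp).
have [|[x ex]|[x ex]] := pp f q.
- by rewrite -e polyCM -mulrA; exists (a%:P * g).
- case: (irreducible_divides irr ex).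
    by rewrite unit_polyC => up; case: irrp; rewrite up.
  rewrite poly_unitE => /andP[/eqP sx _].
  have [y y0 exx] := size1_polyCP sx.
  by move: szf; rewrite ex exx -polyCM ltnNge size_polyC leq_b1.
- have p0 : p%:P != 0 :> {poly R} by rewrite polyC_eq0 irreducible_neq0.
  exists x; apply: (mulfI p0).
  by rewrite mulrA -polyCM e ex mulrCA.
Qed.

Lemma pseudo_divides f g : irreducible_elt f -> (1 < size f)%N ->
  f %| g -> divides f g.
Proof.
move=> irr sf; rewrite Pdiv.Idomain.dvdp_eq => /eqP e.
have l0 : lead_coef f ^+ scalp g f != 0.
  by rewrite expf_neq0 // lead_coef_eq0 irreducible_neq0.
apply: (divides_cancel_polyC irr sf l0); exists (g %/ f).
by rewrite mul_polyC e mulrC.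
Qed.

Lemma irreducible_prime_poly f : irreducible_elt f -> prime_elt f.
Proof.
move=> irr; have f0 := irreducible_neq0 irr.
have [sf|sf] := leqP (size f) 1.
  have sf1 : size f = 1%N.
    by apply/eqP; rewrite eqn_leq sf size_poly_gt0.
  have [c c0 e] := size1_polyCP sf1; rewrite e; apply: prime_polyC.
  by apply: (ufd_prime HR); apply: irreducible_polyC; rewrite -e.
move=> a b dab.
case: (boolP (coprimep f a)) => [cop|ncop].
  right; apply: pseudo_divides => //.
  rewrite -(Pdiv.Idomain.Gauss_dvdpr b cop).
  by case: dab => x ->; apply: Pdiv.Idomain.dvdp_mulr.
left; apply: pseudo_divides => //.
set h := gcdp f a.
have h0 : h != 0 by rewrite gcdp_eq0 (negbTE f0).
have sh : (1 < size h)%N.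
  by move: ncop; rewrite /coprimep -/h; move: h0; rewrite -size_poly_gt0; lia.
have hf : h %| f by apply: dvdp_gcdl.
apply: Pdiv.Idomain.dvdp_trans (dvdp_gcdr f a); rewrite -/h.
suff e : size h = size f.
  by have := Pdiv.Idomain.dvdp_size_eqp hf; rewrite e eqxx => /esym/andP[].
move: hf; rewrite Pdiv.Idomain.dvdp_eq => /eqP.
set c := _ ^+ _ => ec.
have c0 : c != 0 by rewrite expf_neq0 // lead_coef_eq0.
(* Distribute the prime factors of [c] over the two factors of [c *: f]. *)
have gen : forall u v : {poly R}, c%:P * f = u * v -> exists u' v' : {poly R},
    [/\ f = u' * v', size u' = size u & size v' = size v].
  elim/irreducible_factor_ind: c / c0 {ec} => [//|u uu g1 g2 e|].
    exists (u^-1%:P * g1), g2; split=> //.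
      by rewrite -mulrA -e mulrA -polyCM mulVr // mul1r.
    by rewrite mul_polyC size_scale // invr_eq0; apply: contraTneq uu => ->; rewrite unitr0.
  move=> p c irrp IH u v e.
  have p0 : p != 0 by rewrite irreducible_neq0.
  have pp0 : p%:P != 0 :> {poly R} by rewrite polyC_eq0.
  have [|[x ex]|[x ex]] := prime_polyC (ufd_prime HR irrp) (a := u) (b := v).
  - by rewrite -e polyCM -mulrA; exists (c%:P * f).
  - have [|u' [v' [ef su sv]]] := IH x v.
      by apply: (mulfI pp0); rewrite !mulrA -polyCM e ex.
    by exists u', v'; rewrite ex mul_polyC size_scale.
  - have [|u' [v' [ef su sv]]] := IH u x.
      by apply: (mulfI pp0); rewrite !mulrA -polyCM e ex mulrCA !mulrA.
    by exists u', v'; rewrite ex mul_polyC size_scale.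
have [|u [v [ef su sv]]] := gen (f %/ h) h; first by rewrite mul_polyC.
case: (irreducible_divides irr ef); rewrite poly_unitE => /andP[/eqP s1 _].
  rewrite ef size_mul -?size_poly_gt0 ?s1 ?sv //; last exact: ltnW.
by rewrite -sv s1 in sh.
Qed.

Lemma poly_is_ufd : is_ufd {poly R}.
Proof.
split; first exact: irreducible_prime_poly.
have [mu Hmu] := ufd_acc HR.
exists (fun f => (mu (lead_coef f) + size f)%N) => f g fg0.
have f0 : f != 0 by apply: contraNneq fg0 => ->; rewrite mul0r.
have g0 : g != 0 by apply: contraNneq fg0 => ->; rewrite mulr0.
have l0 : lead_coef f * lead_coef g != 0 by rewrite mulf_neq0 // lead_coef_eq0.
have [le1 lt1] := Hmu _ _ l0.
rewrite lead_coefM size_mul //.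
have sg : (0 < size g)%N by rewrite size_poly_gt0.
have [k sk] : exists k, size g = k.+1 by exists (size g).-1; rewrite prednK.
have lg : lead_coef g = g`_k by rewrite lead_coefE sk.
have le2 : (size f <= size f + k)%N := leq_addr _ _.
rewrite sk addnS /=; split; first exact: leq_add.
rewrite poly_unitE negb_and => ng.
have [k0|k_gt0] := posnP k; last by rewrite -addnS leq_add // -addn1 leq_add2l.
have u0 : lead_coef g \isn't a GRing.unit.
  by case/orP: ng; rewrite lg k0 // => /eqP[]; rewrite sk k0.
by rewrite -addSn leq_add // lt1.
Qed.

(* Bezout for polynomials over a unique factorization domain: without a common
   factor of positive degree, the ideal they span meets the coefficients. *)
Lemma coprime_elimination f g :
  (forall h, irreducible_elt h -> (1 < size h)%N ->
     divides h f -> divides h g -> False) ->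
  exists c, c != 0 /\ exists u v, u * f + v * g = c%:P.
Proof.
move=> noc.
have cop : coprimep f g.
  rewrite /coprimep; apply: contraT => nc.
  have [d0|d0] := eqVneq (gcdp f g) 0.
    have /andP[/eqP f0 /eqP g0] : (f == 0) && (g == 0) by rewrite -gcdp_eq0 d0.
    have irrX : irreducible_elt ('X : {poly R}).
      split; first by rewrite poly_unitE size_polyX.
      move=> [a [b [na nb e]]].
      have X0 : 'X != 0 :> {poly R} by rewrite polyX_eq0.
      have a0 : a != 0 by apply: contraNneq X0 => a0; rewrite e a0 mul0r.
      have b0 : b != 0 by apply: contraNneq X0 => b0; rewrite e b0 mulr0.
      have l1 : lead_coef a * lead_coef b = 1 by rewrite -lead_coefM -e lead_coefX.
      have : size ('X : {poly R}) = 2 by rewrite size_polyX.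
      rewrite {1}e size_mul // => s2.
      have ua : lead_coef a \is a GRing.unit by apply/unitrP; exists (lead_coef b); rewrite mulrC l1.
      have ub : lead_coef b \is a GRing.unit by apply/unitrP; exists (lead_coef a); split; rewrite // mulrC l1.
      have sa : (0 < size a)%N by rewrite size_poly_gt0.
      have sb : (0 < size b)%N by rewrite size_poly_gt0.
      have [s1|s1] : size a = 1%N \/ size b = 1%N by move: s2 sa sb; lia.
        by move: na ua; rewrite poly_unitE s1 eqxx lead_coefE s1 /= => /negbTE ->.
      by move: nb ub; rewrite poly_unitE s1 eqxx lead_coefE s1 /= => /negbTE ->.
    by case: (noc _ irrX); rewrite ?size_polyX ?f0 ?g0 //; apply: divides0.
  have sd : (1 < size (gcdp f g))%N by move: nc d0; rewrite -size_poly_gt0; lia.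
  have [h [irr sh dh]] : exists h, [/\ irreducible_elt h, (1 < size h)%N & divides h (gcdp f g)].
    elim/irreducible_factor_ind: (gcdp f g) / d0 sd {nc} => [|u|].
    - exact: poly_is_ufd.
    - by rewrite poly_unitE => /andP[/eqP ->].
    move=> p a irr IH spa; have p0 := irreducible_neq0 irr.
    have [sp|sp] := boolP (1 < size p)%N; first by exists p; split=> //; exists a.
    have a0 : a != 0 by apply: contraTneq spa => ->; rewrite mulr0 size_poly0.
    have [] := IH.
      have p1 : size p = 1%N.
        by apply/eqP; rewrite eqn_leq leqNgt sp size_poly_gt0.
      by move: spa; rewrite size_mul // p1.
    by move=> h [irrh sh dh]; exists h; split=> //; apply: divides_mull.
  have hd x : gcdp f g %| x -> divides h x.
    rewrite Pdiv.Idomain.dvdp_eq => /eqP e.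
    have l0 : lead_coef (gcdp f g) ^+ scalp x (gcdp f g) != 0.
      by rewrite expf_neq0 // lead_coef_eq0 -size_poly_gt0 ltnW.
    apply: (divides_cancel_polyC irr sh l0); rewrite mul_polyC e.
    exact: divides_mull.
  by case: (noc h irr sh); apply: hd; rewrite ?dvdp_gcdl ?dvdp_gcdr.
have /Pdiv.Idomain.Bezout_coprimepP [[u v] /= e1] := cop.
exists (lead_coef (u * f + v * g)); split; last first.
  exists u, v; have /Pdiv.Idomain.eqp_eq := e1.
  by rewrite lead_coef1 scale1r => {1}->; rewrite alg_polyC.
rewrite lead_coef_eq0; apply: contraTneq e1 => ->.
by rewrite eqp_sym eqp0 oner_eq0.
Qed.

End Gauss.

(** * Multivariate polynomials *)

Lemma mpoly_hom_ext (n : nat) (R : nzRingType) (S : comNzRingType)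
    (f g : {rmorphism {mpoly R[n]} -> S}) :
  (forall c, f c%:MP = g c%:MP) -> (forall i, f 'X_i = g 'X_i) -> f =1 g.
Proof.
move=> fC fX p; rewrite (mpolyE p) !raddf_sum; apply: eq_bigr => m _ /=.
rewrite -mul_mpolyC !rmorphM fC mpolyXE_id !rmorph_prod; congr (_ * _).
by apply: eq_bigr => i _; rewrite !rmorphXn fX.
Qed.

Lemma is_ufd_iso (R S : idomainType) (f : {rmorphism R -> S})
    (g : {rmorphism S -> R}) :
  cancel f g -> cancel g f -> is_ufd S -> is_ufd R.
Proof.
move=> fK gK [pS [mu Hmu]].
have unitf x : (f x \is a GRing.unit) = (x \is a GRing.unit).
  by apply/idP/idP => [u|]; [rewrite -(fK x) rmorph_unit | apply: rmorph_unit].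
have f0 x : (f x == 0) = (x == 0).
  by rewrite -(can_eq fK) rmorph0.
split.
  move=> p [nu irr] a b [c e].
  have irrf : irreducible_elt (f p).
    split; first by rewrite unitf.
    move=> [x [y [nx ny exy]]]; apply: irr; exists (g x), (g y); split.
    - by rewrite -unitf gK.
    - by rewrite -unitf gK.
    - by rewrite -rmorphM -exy fK.
  have back x : divides (f p) (f x) -> divides p x.
    by move=> [y ey]; exists (g y); rewrite -(fK x) ey rmorphM fK.
  case: (pS _ irrf (f a) (f b)).
  - by exists (f c); rewrite -!rmorphM e.
  - by move/back; left.
  - by move/back; right.
exists (mu \o f) => a b ab0 /=; rewrite rmorphM -unitf.
by apply: Hmu; rewrite -rmorphM f0.
Qed.

Lemma field_is_ufd (K : fieldType) : is_ufd K.
Proof.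
split; last first.
  exists (fun _ => 0%N) => a b; rewrite mulf_eq0 negb_or => /andP[_ b0].
  by split=> //; rewrite unitfE b0.
move=> p irr; have := irreducible_neq0 irr.
by case: irr; rewrite unitfE => /negbNE/eqP -> _; rewrite eqxx.
Qed.

Lemma widen_or_max (n : nat) (i : 'I_n.+1) :
  (exists j, i = widen_ord (leqnSn n) j) \/ i = ord_max.
Proof.
have [lt_in|le_ni] := ltnP i n.
  by left; exists (Ordinal lt_in); apply: val_inj.
by right; apply: val_inj; apply/eqP; rewrite eqn_leq le_ni -ltnS ltn_ord.
Qed.

Section Muni.
Variables (n : nat) (R : idomainType).
Implicit Types (p q : {mpoly R[n.+1]}).
Local Notation widen := (widen_ord (leqnSn n)).

Lemma muniX_widen (i : 'I_n) : muni ('X_(widen i) : {mpoly R[n.+1]}) = ('X_i)%:P.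
Proof.
rewrite muniE msuppX big_seq1 mcoeffX eqxx scale1r.
have -> : U_(widen i)%MM ord_max = 0%N.
  by rewrite mnm1E; case: eqP => // /(congr1 val) /= e; have := ltn_ord i; rewrite e ltnn.
rewrite expr0 alg_polyC; congr ('X_[_])%:P; apply/mnmP => j.
by rewrite mnmE !mnm1E -val_eqE.
Qed.

Lemma muniX_max : muni ('X_ord_max : {mpoly R[n.+1]}) = 'X.
Proof.
rewrite muniE msuppX big_seq1 mcoeffX eqxx scale1r mnm1E eqxx expr1.
have -> : [multinom U_(ord_max)%MM (widen i) | i < n] = 0%MM.
  apply/mnmP => j; rewrite mnmE mnm1E mnm0E.
  by case: eqP => // /(congr1 val) /= e; have := ltn_ord j; rewrite -e ltnn.
by rewrite mpolyX0 scale1r.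
Qed.

Definition muni_inv : {poly {mpoly R[n]}} -> {mpoly R[n.+1]} :=
  horner_eval 'X_ord_max \o map_poly (@mwiden n R).

HB.instance Definition _ := GRing.RMorphism.on muni_inv.

Lemma muni_invC c : muni_inv c%:P = mwiden c.
Proof. by rewrite /muni_inv /= map_polyC /horner_eval hornerC. Qed.

Lemma muni_invX : muni_inv 'X = 'X_ord_max.
Proof. by rewrite /muni_inv /= map_polyX /horner_eval hornerX. Qed.

Lemma mwidenXU (i : 'I_n) : mwiden ('X_i : {mpoly R[n]}) = 'X_(widen i).
Proof. by rewrite mwidenX mnmwiden1. Qed.

Lemma muniK : cancel (@muni n R) muni_inv.
Proof.
apply: (@mpoly_hom_ext _ _ _ (muni_inv \o @muni n R) idfun) => [c|i] /=.
  by rewrite muniC muni_invC mwidenC.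
have [[j ->]|->] := widen_or_max i.
  by rewrite muniX_widen muni_invC mwidenXU.
by rewrite muniX_max muni_invX.
Qed.

Lemma muni_mwiden (c : {mpoly R[n]}) : muni (mwiden c) = c%:P.
Proof.
apply: (@mpoly_hom_ext _ _ _ (@muni n R \o @mwiden n R) polyC) => [x|i] /=.
  by rewrite mwidenC muniC.
by rewrite mwidenXU muniX_widen.
Qed.

Lemma muni_invK : cancel muni_inv (@muni n R).
Proof.
move=> q; elim/poly_ind: q => [|q c IH]; first by rewrite !rmorph0.
by rewrite !rmorphD !rmorphM /= IH muni_invX muni_invC muniX_max muni_mwiden.
Qed.

Lemma muni_eq0 p : (muni p == 0) = (p == 0).
Proof. by rewrite -(can_eq muniK) rmorph0. Qed.

End Muni.

Lemma mpoly_is_ufd (K : fieldType) (n : nat) : is_ufd {mpoly K[n]}.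
Proof.
elim: n => [|n IH]; last first.
  exact: (is_ufd_iso (@muniK n K) (@muni_invK n K) (poly_is_ufd IH)).
pose ev := @meval 0 K (fun=> 0).
apply: (@is_ufd_iso _ _ ev (@mpolyC 0 K) _ _ (field_is_ufd K)) => [p|c].
  apply: (@mpoly_hom_ext _ _ _ (@mpolyC 0 K \o ev) idfun) => [c|[]//] /=.
  by rewrite /ev mevalC.
exact: mevalC.
Qed.

Definition vext (n : nat) (T : Type) (v : 'I_n -> T) (s : T) : 'I_n.+1 -> T :=
  fun i => if unlift ord_max i is Some j then v j else s.

Lemma vext_max (n : nat) (T : Type) (v : 'I_n -> T) s : vext v s ord_max = s.
Proof. by rewrite /vext unlift_none. Qed.

Lemma vext_widen (n : nat) (T : Type) (v : 'I_n -> T) s i :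
  vext v s (widen_ord (leqnSn n) i) = v i.
Proof.
have -> : widen_ord (leqnSn n) i = lift ord_max i.
  by apply: val_inj; rewrite /= /bump leqNgt ltn_ord.
by rewrite /vext liftK.
Qed.

Lemma meval_map_muni (n : nat) (R S : idomainType) (u : 'I_n.+1 -> S)
    (f : {rmorphism R -> S}) (phi : {rmorphism {mpoly R[n]} -> S})
    (p : {mpoly R[n.+1]}) :
  (forall c, phi c%:MP = f c) ->
  (forall i, phi 'X_i = u (widen_ord (leqnSn n) i)) ->
  (map_poly phi (muni p)).[u ord_max] = mmap f u p.
Proof.
move=> fC fX.
apply: (@mpoly_hom_ext _ _ _
  (horner_eval (u ord_max) \o map_poly phi \o @muni n R) (mmap f u)) => [c|i] /=.
  by rewrite muniC map_polyC /= fC mmapC /horner_eval hornerC.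
rewrite mmapX mmap1U; have [[j ->]|->] := widen_or_max i.
  by rewrite muniX_widen map_polyC /= fX /horner_eval hornerC.
by rewrite muniX_max map_polyX /horner_eval hornerX.
Qed.

Section Line.
Variables (n : nat) (R : idomainType).
Implicit Types (p q : {mpoly R[n.+1]}) (v : 'I_n -> R).

Definition line v : {mpoly R[n.+1]} -> {poly R} := map_poly (meval v) \o @muni n R.

HB.instance Definition _ v := GRing.RMorphism.on (line v).

Lemma horner_line v p s : (line v p).[s] = p.@[vext v s].
Proof.
rewrite -{1}(vext_max v s); apply: meval_map_muni => [c|i] /=.
  by rewrite mevalC.
by rewrite mevalXU vext_widen.
Qed.

Lemma lineM v p q : line v (p * q) = line v p * line v q.
Proof. exact: rmorphM. Qed.

Lemma line_mul_root v p q s : (line v p).[s] = 0 -> (line v (p * q)).[s] = 0.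
Proof.
rewrite lineM; move: (line v p) (line v q) => a b ps.
by rewrite hornerM ps mul0r.
Qed.

End Line.

Lemma meval_msym (n : nat) (R : idomainType) (s : 'S_n) (p : {mpoly R[n]}) v :
  (msym s p).@[v] = p.@[v \o s].
Proof.
apply: (@mpoly_hom_ext _ _ _ (meval v \o msym s) (meval (v \o s))) => [c|i] /=.
  by rewrite /msym mmapC !mevalC.
by rewrite /msym mmapX mmap1U !mevalXU.
Qed.

Section Depends.
Variables (n : nat) (R : idomainType).
Implicit Types (p q : {mpoly R[n]}).

Definition depends (j : 'I_n) p := has (fun m : 'X_{1..n} => m j != 0%N) (msupp p).

Lemma depends_msym (s : 'S_n) j p : depends (s j) (msym s p) = depends j p.
Proof.
apply/hasP/hasP => -[m]; rewrite mcoeff_msupp.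
  rewrite mcoeff_sym => pm mj; exists [multinom m (s i) | i < n].
    by rewrite mcoeff_msupp.
  by rewrite mnmE.
move=> pm mj; exists [multinom m (s^-1%g i) | i < n].
  rewrite mcoeff_msupp mcoeff_sym.
  suff -> : [multinom [multinom m (s^-1%g i) | i < n] (s i) | i < n] = m by [].
  by apply/mnmP => i; rewrite !mnmE permK.
by rewrite mnmE permK.
Qed.

Lemma eq_meval_depends p v w :
  (forall j, depends j p -> v j = w j) -> p.@[v] = p.@[w].
Proof.
move=> vw; rewrite !mevalE; apply: eq_big_seq => m pm.
congr (_ * _); apply: eq_bigr => i _.
have [->|mi] := eqVneq (m i) 0%N; first by rewrite !expr0.
by rewrite vw //; apply/hasP; exists m.
Qed.

Lemma not_depends_const p : (forall j, ~~ depends j p) -> p = (p@_0)%:MP.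
Proof.
move=> nd; apply: msize1_polyC; rewrite msizeE.
apply/bigmax_leqP_seq => m pm _; rewrite ltnS leqn0 mdeg_eq0.
apply/eqP/mnmP => j; rewrite mnm0E; apply/eqP; apply: contraT => mj.
by have /hasP := nd j; case; exists m.
Qed.

End Depends.

Lemma depends_max (n : nat) (R : idomainType) (p : {mpoly R[n.+1]}) :
  (1 < size (muni p))%N = depends ord_max p.
Proof.
apply/idP/idP; last first.
  apply: contraTT; rewrite -leqNgt => /size1_polyC; set c := _`_0 => e.
  apply/hasPn => m; rewrite negbK; apply: contraTeq => mmax.
  rewrite -(muniK p) e muni_invC (mpolyE c) raddf_sum /=.
  rewrite mcoeff_msupp raddf_sum /= big1 ?eqxx // => k _.
  rewrite mwidenZ mwidenX mcoeffZ mcoeffX; case: eqP => [ek|]; rewrite ?mulr0 //.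
  by rewrite -ek mnmwiden_ordmax eqxx in mmax.
apply: contraTT => /hasPn nd; rewrite -leqNgt muniE.
apply: leq_trans (size_sum _ _ _) _; apply/bigmax_leqP_seq => m /nd.
rewrite negbK => /eqP -> _; rewrite expr0 alg_polyC.
exact: size_polyC_leq1.
Qed.

Lemma size_mul_gt1 (R : idomainType) (p q : {poly R}) : p != 0 -> q != 0 ->
  (1 < size (p * q)%R)%N = (1 < size p)%N || (1 < size q)%N.
Proof.
move=> p0 q0; rewrite size_mul // -subn1 ltn_subRL.
have sp : (0 < size p)%N by rewrite size_poly_gt0.
have sq : (0 < size q)%N by rewrite size_poly_gt0.
by apply/idP/idP; lia.
Qed.

Lemma depends_mul (n : nat) (R : idomainType) (j : 'I_n) (p q : {mpoly R[n]}) :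
  p * q != 0 -> depends j (p * q) = depends j p || depends j q.
Proof.
case: n j p q => [[]//|n] j p q.
wlog -> : j p q / j = ord_max.
  move=> H pq0; set t := tperm j ord_max.
  rewrite -(depends_msym t j (p * q)) -(depends_msym t j p) -(depends_msym t j q).
  rewrite tpermL msymM; apply: H => //.
  by rewrite -msymM; apply: contraNneq pq0 => e; rewrite -(inj_eq (@inj_msym _ _ t)) e msym0.
rewrite mulf_eq0 negb_or => /andP[p0 q0]; rewrite -!depends_max muniM.
have {}p0 : muni p != 0 by rewrite muni_eq0.
have {}q0 : muni q != 0 by rewrite muni_eq0.
exact: (size_mul_gt1 p0 q0).
Qed.

Section ClosedField.
Variable K : closedFieldType.

Lemma exists_root (p : {poly K}) : (1 < size p)%N -> exists s, p.[s] = 0.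
Proof. by move=> sp; have [|s /rootP] := closed_rootP p _; [lia|exists s]. Qed.

Lemma exists_nonroot (p : {poly K}) : p != 0 -> exists s, p.[s] != 0.
Proof.
move=> p0; have [s1|s1] := leqP (size p) 1.
  exists 0; rewrite (size1_polyC s1) hornerC; apply: contraNneq p0 => e.
  by rewrite (size1_polyC s1) e.
have [|s] := exists_root (p := p - 1).
  by rewrite size_polyDl // size_polyN size_poly1.
by rewrite hornerD hornerN hornerC => /eqP; rewrite subr_eq0 => /eqP e; exists s; rewrite e oner_eq0.
Qed.

Lemma exists_nonzero (n : nat) (p : {mpoly K[n]}) : p != 0 -> exists v, p.@[v] != 0.
Proof.
elim: n p => [|n IH] p p0.
  exists (fun=> 0); apply: contraNneq p0 => e; apply/eqP.
  have -> : p = (p@_0)%:MP by apply: not_depends_const => -[].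
  by move: e; rewrite [p]not_depends_const ?mevalC ?mcoeffC => [|[]//]; rewrite eqxx mulr1 => ->.
have [|v lv] := IH (lead_coef (muni p)); first by rewrite lead_coef_eq0 muni_eq0.
have [|s ps] := @exists_nonroot (line v p).
  by rewrite /line /= -size_poly_eq0 size_map_poly_id0 // size_poly_eq0 muni_eq0.
by exists (vext v s); rewrite -horner_line.
Qed.

End ClosedField.

(** * Alternants *)

Definition alt (R : comNzRingType) (r : nat) (e : 'I_r -> nat) (v : 'I_r -> R) : R :=
  \det (\matrix_(i, j) v i ^+ e j).

Definition rho (r : nat) (j : 'I_r) : nat := (r.-1 - j)%N.

Section Alternant.
Variables (R : comNzRingType) (r : nat).
Implicit Types (e : 'I_r -> nat) (v : 'I_r -> R).

Lemma eq_alt e e' v v' : e =1 e' -> v =1 v' -> alt e v = alt e' v'.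
Proof.
by move=> ee vv; congr (\det _); apply/matrixP => i j; rewrite !mxE ee vv.
Qed.

Lemma rmorph_alt (S : comNzRingType) (f : {rmorphism R -> S}) e v :
  f (alt e v) = alt e (f \o v).
Proof.
rewrite /alt -det_map_mx; congr (\det _); apply/matrixP => i j.
by rewrite !mxE rmorphXn.
Qed.

Lemma alt_perm (s : 'S_r) e v : alt e (v \o s) = (-1) ^+ s * alt e v.
Proof.
rewrite /alt -det_perm -det_mulmx -row_permE; congr (\det _).
by apply/matrixP => i j; rewrite !mxE.
Qed.

Lemma alt_perm_exp (s : 'S_r) e v : alt (e \o s) v = (-1) ^+ s * alt e v.
Proof.
rewrite /alt -[s in RHS]invgK odd_permV -det_perm mulrC -det_mulmx -col_permE.
by congr (\det _); apply/matrixP => i j; rewrite !mxE.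
Qed.

Lemma alt_repeat e v (i j : 'I_r) : i != j -> v i = v j -> alt e v = 0.
Proof.
move=> ij vij; apply: (determinant_alternate ij) => k.
by rewrite !mxE vij.
Qed.

Lemma alt_pow e v d : alt e (fun i => v i ^+ d) = alt (fun j => d * e j)%N v.
Proof.
by congr (\det _); apply/matrixP => i j; rewrite !mxE exprM.
Qed.

Lemma alt_scale e v t : alt e (fun i => t * v i) = t ^+ (\sum_j e j) * alt e v.
Proof.
rewrite /alt.
have -> : \matrix_(i, j) (t * v i) ^+ e j =
   (\matrix_(i, j) v i ^+ e j) *m diag_mx (\row_j t ^+ e j).
  by apply/matrixP => i j; rewrite mul_mx_diag !mxE exprMn mulrC.
rewrite det_mulmx det_diag mulrC; congr (_ * _).
by rewrite -prodrXr; apply: eq_bigr => j _; rewrite mxE.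
Qed.

Definition rev_perm : 'S_r := perm (@rev_ord_inj r).

Lemma alt_rho_val v :
  alt (@rho r) v = (-1) ^+ rev_perm * alt (fun j : 'I_r => nat_of_ord j) v.
Proof.
rewrite -alt_perm_exp; apply: eq_alt => // j; rewrite /rho /= permE /=.
by case: r j => [[]//|k] j; rewrite subSS.
Qed.

Lemma alt_rho v :
  alt (@rho r) v = (-1) ^+ rev_perm * \prod_(i < r) \prod_(j < r | (i < j)%N) (v j - v i).
Proof.
rewrite alt_rho_val; congr (_ * _).
have := det_Vandermonde (\row_i v i).
under eq_bigr => i _ do under eq_bigr => j _ do rewrite !mxE.
move=> <-; rewrite -det_tr; congr (\det _).
by apply/matrixP => i j; rewrite !mxE.
Qed.

End Alternant.

Lemma alt_rho_neq0 (R : idomainType) (r : nat) (v : 'I_r -> R) :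
  injective v -> alt (@rho r) v != 0.
Proof.
move=> vi; rewrite alt_rho mulf_neq0 ?signr_eq0 //.
apply/prodf_neq0 => i _; apply/prodf_neq0 => j ij.
by rewrite subr_eq0 (inj_eq vi) eq_sym; apply: contraTneq ij => ->; rewrite ltnn.
Qed.

Lemma mpolyX_inj (R : comNzRingType) (n : nat) : injective (fun i => 'X_i : {mpoly R[n]}).
Proof.
move=> i j /(congr1 (meval (fun k => (k == i)%:R))).
by rewrite !mevalXU eqxx; case: eqP => // _ /eqP; rewrite oner_eq0.
Qed.

(* Reducing the powers [x ^ e] modulo [\prod_k (x - v k)] factors the matrix of an
   alternant through the Vandermonde matrix. *)
Lemma alt_quotient (R : comNzRingType) (r : nat) (e : 'I_r -> nat) (v : 'I_r -> R) :
  exists q, alt e v = alt (@rho r) v * q.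
Proof.
pose chi : {poly R} := \prod_(k < r) ('X - (v k)%:P).
have mchi : chi \is monic by apply: monic_prod_XsubC.
have schi : size chi = r.+1.
  by rewrite /chi size_prod_XsubC /index_enum -enumT size_enum_ord.
pose m (a : nat) := Pdiv.Ring.rmodp ('X^a) chi.
have em (i : 'I_r) a : v i ^+ a = \sum_(l < r) (m a)`_l * v i ^+ l.
  have := Pdiv.RingMonic.rdivp_eq mchi 'X^a => /(congr1 (fun p => p.[v i])).
  rewrite hornerXn hornerD hornerM.
  have -> : chi.[v i] = 0.
    by rewrite /chi horner_prod (bigD1 i) //= hornerXsubC subrr mul0r.
  rewrite mulr0 add0r => ->; apply: horner_coef_wide.
  rewrite -ltnS -schi; apply: Pdiv.CommonRing.ltn_rmodpN0.
  exact: monic_neq0.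
exists ((-1) ^+ rev_perm r * \det (\matrix_(l < r, j < r) (m (e j))`_l)).
rewrite alt_rho_val mulrACA -expr2 sqrr_sign mul1r -det_mulmx; congr (\det _).
apply/matrixP => i j; rewrite !mxE em; apply: eq_bigr => l _.
by rewrite !mxE mulrC.
Qed.

(** * The three-term Pluecker relation *)

Section Bracket.
Variables (R : idomainType) (n : nat) (w : 'I_n.+1 -> 'I_n.+1 -> R).
Hypothesis n_gt0 : (0 < n)%N.
Implicit Types a b c e : 'I_n.+1 -> R.

Definition bracket_row a b (i : 'I_n.+1) : 'I_n.+1 -> R :=
  if i == ord0 then a else if i == ord_max then b else w i.

Definition bracket a b : R := \det (\matrix_(i, j) bracket_row a b i j).

Let max_neq0 : (ord_max == ord0 :> 'I_n.+1) = false.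
Proof. by rewrite -val_eqE /= eqn0Ngt n_gt0. Qed.

Lemma bracket_repeat a b i i' : i != i' ->
  bracket_row a b i =1 bracket_row a b i' -> bracket a b = 0.
Proof.
move=> ii e; apply: (determinant_alternate ii) => j.
by rewrite !mxE e.
Qed.

Lemma bracketxx a : bracket a a = 0.
Proof.
apply: (@bracket_repeat a a ord0 ord_max); first by rewrite eq_sym max_neq0.
by move=> j; rewrite /bracket_row max_neq0 !eqxx.
Qed.

Lemma bracketC a b : bracket b a = - bracket a b.
Proof.
have sg : -1 = (-1) ^+ tperm ord0 (@ord_max n) :> R.
  by rewrite odd_tperm eq_sym max_neq0.
rewrite -mulN1r sg.
rewrite /bracket -det_perm -det_mulmx -row_permE; congr (\det _).
apply/matrixP => i j; rewrite !mxE /bracket_row.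
case: tpermP => [->|->|]; rewrite ?eqxx ?max_neq0 //.
by move=> /eqP/negbTE -> /eqP/negbTE ->.
Qed.

Definition bracket_cof b j := cofactor (\matrix_(i, j) bracket_row (fun=> 0) b i j) ord0 j.

Lemma bracket_linear a b : bracket a b = \sum_j a j * bracket_cof b j.
Proof.
rewrite /bracket (expand_det_row _ ord0); apply: eq_bigr => j _.
rewrite !mxE /bracket_row eqxx; congr (_ * (_ * \det _)).
by apply/matrixP => i k; rewrite !mxE /bracket_row.
Qed.

Let plucker_nz a b c e : bracket b c != 0 ->
  bracket a b * bracket c e - bracket a c * bracket b e + bracket a e * bracket b c = 0.
Proof.
pose L x := bracket x b * bracket c e - bracket x c * bracket b e + bracket x e * bracket b c.
rewrite -/(L a) => D0; set D := bracket b c in D0.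
pose M : 'M[R]_n.+1 := \matrix_(i, j) bracket_row b c i j.
pose t := (\row_j a j) *m \adj M.
have ea j : D * a j = \sum_i t 0 i * M i j.
  have /(congr1 (fun A : 'rV_n.+1 => A 0 j)) : t *m M = D *: \row_j a j.
    by rewrite /t -mulmxA mul_adj_mx mul_mx_scalar.
  by rewrite !mxE => <-.
have eb x : D * bracket a x = \sum_i t 0 i * bracket (bracket_row b c i) x.
  rewrite bracket_linear mulr_sumr.
  under eq_bigr => j _ do rewrite mulrA ea mulr_suml.
  rewrite exchange_big /=; apply: eq_bigr => i _.
  rewrite bracket_linear mulr_sumr; apply: eq_bigr => j _.
  by rewrite -mulrA; congr (_ * (_ * _)); rewrite mxE.
have LM i : L (bracket_row b c i) = 0.
  rewrite /L /bracket_row; case: eqP => [_|/eqP i0].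
    by rewrite bracketxx; ring.
  case: eqP => [_|/eqP im].
    by rewrite bracketxx (bracketC b c); ring.
  have z x : bracket (w i) x = 0.
    apply: (@bracket_repeat _ _ ord0 i); first by rewrite eq_sym.
    by move=> j; rewrite /bracket_row eqxx (negbTE i0) (negbTE im).
  by rewrite !z; ring.
apply: (mulfI D0); rewrite mulr0 /L.
transitivity (\sum_i t 0 i * L (bracket_row b c i)).
  rewrite mulrDr mulrBr !mulrA !eb !mulr_suml -sumrB -big_split /=.
  by apply: eq_bigr => i _; rewrite /L; ring.
by rewrite big1 // => i _; rewrite LM mulr0.
Qed.

Lemma plucker a b c e :
  bracket a b * bracket c e - bracket a c * bracket b e + bracket a e * bracket b c = 0.
Proof.
have [bc|/plucker_nz //] := eqVneq (bracket b c) 0.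
have [be|/(plucker_nz a c)] := eqVneq (bracket b e) 0; last first.
  move=> H; rewrite -[RHS]oppr0 -[X in _ = - X]H (bracketC c e); ring.
have [ce|/(plucker_nz a b)] := eqVneq (bracket c e) 0; first by rewrite bc be ce; ring.
by move=> <-; rewrite (bracketC b e) (bracketC b c); ring.
Qed.

End Bracket.

(** * The quotient of two alternants *)

Definition two_points (T : Type) (n : nat) (w : 'I_n.+1 -> T) (a b : T) : 'I_n.+1 -> T :=
  fun i => if i == ord0 then a else if i == ord_max then b else w i.

Lemma alt_two_points (R : idomainType) (n : nat) (e : 'I_n.+1 -> nat) w (a b : R) :
  alt e (two_points w a b) =
  bracket (fun i j => w i ^+ e j) (fun j => a ^+ e j) (fun j => b ^+ e j).
Proof.
congr (\det _); apply/matrixP => i j; rewrite !mxE /two_points /bracket_row.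
by case: eqP => // _; case: eqP.
Qed.

Section TwoPoints.
Variables (R : idomainType) (n : nat) (w : 'I_n.+1 -> R).
Hypothesis n_gt0 : (0 < n)%N.

Let mid (i : 'I_n.+1) := (i != ord0) && (i != ord_max).

Lemma alt_rho_two_points : injective w -> exists2 g, g != 0 & forall a b,
  alt (@rho n.+1) (two_points w a b) =
  g * (\prod_(i | mid i) (w i - a)) * (\prod_(i | mid i) (w i - b)) * (b - a).
Proof.
pose G := \prod_(i < n.+1 | mid i) \prod_(j < n.+1 | (i < j)%N && (j != ord_max)) (w j - w i).
move=> winj; exists ((-1) ^+ rev_perm n.+1 * (-1) ^+ #|mid| * G) => [|a b].
  rewrite !mulf_neq0 ?signr_eq0 //.
  apply/prodf_neq0 => i _; apply/prodf_neq0 => j /andP[ij _].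
  by rewrite subr_eq0 (inj_eq winj) eq_sym; apply: contraTneq ij => ->; rewrite ltnn.
have m0 : (ord_max == ord0 :> 'I_n.+1) = false by rewrite -val_eqE /= eqn0Ngt n_gt0.
rewrite alt_rho -!mulrA; congr (_ * _).
rewrite (bigD1 ord0) //= (bigD1 ord_max) //= {1 2}/two_points m0 !eqxx.
have -> : \prod_(i < n.+1 | (0 < i)%N && (i != ord_max))
   (two_points w a b i - two_points w a b ord0) = \prod_(i | mid i) (w i - a).
  apply: eq_big => [i|i /andP[i0 im]]; first by rewrite /mid lt0n -val_eqE.
  by rewrite /two_points eqxx -val_eqE /= gtn_eqF // (negbTE im).
rewrite [X in _ * X](bigD1 ord_max) ?m0 //=.
have -> : \prod_(j < n.+1 | (n < j)%N) (two_points w a b j - two_points w a b ord_max) = 1.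
  by rewrite big_pred0 // => j; apply/negbTE; rewrite -leqNgt -ltnS ltn_ord.
rewrite mul1r.
have -> : \prod_(i < n.+1 | (i != ord0) && (i != ord_max))
     \prod_(j < n.+1 | (i < j)%N) (two_points w a b j - two_points w a b i)
   = \prod_(i | mid i) ((b - w i) *
       \prod_(j < n.+1 | (i < j)%N && (j != ord_max)) (w j - w i)).
  apply: eq_bigr => i /andP[i0 im]; rewrite (bigD1 ord_max) /=; last first.
    by rewrite ltn_neqAle -val_eqE in im *; rewrite im -ltnS ltn_ord.
  rewrite {1 2}/two_points m0 eqxx (negbTE i0) (negbTE im); congr (_ * _).
  apply: eq_bigr => j /andP[ij jm].
  have j0 : (j == ord0) = false by rewrite -val_eqE /= gtn_eqF // (leq_ltn_trans _ ij).
  by rewrite /two_points j0 (negbTE i0) (negbTE im) (negbTE jm).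
rewrite big_split /= -/G.
have -> : \prod_(i | mid i) (b - w i) = (-1) ^+ #|mid| * \prod_(i | mid i) (w i - b).
  by rewrite -prodrN; apply: eq_bigr => i _; rewrite opprB.
ring.
Qed.

(* After division by the Vandermonde determinant, the bracket of two points is
   [(b - a) * c a b] up to factors that depend on one point at a time. *)
Lemma plucker_quotient (e : 'I_n.+1 -> nat) (q : R -> R -> R) (pts : seq R) :
  injective (fun i => w i) -> {in pts, forall x i, w i != x} ->
  (forall a b, alt e (two_points w a b) = alt (@rho n.+1) (two_points w a b) * q a b) ->
  forall a b c x, a \in pts -> b \in pts -> c \in pts -> x \in pts ->
  let D s t := (s - t) * q s t in D a b * D c x - D a c * D b x + D a x * D b c = 0.
Proof.
move=> winj wpts eq_q a b c x ap bp cp xp D.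
have [g g0 eg] := alt_rho_two_points winj.
pose tau y := \prod_(i | mid i) (w i - y).
have tau0 y : y \in pts -> tau y != 0.
  by move=> yp; apply/prodf_neq0 => i _; rewrite subr_eq0 wpts.
have br s t : bracket (fun i j => w i ^+ e j) (fun j => s ^+ e j) (fun j => t ^+ e j)
    = - (g * tau s * tau t * D s t).
  by rewrite -alt_two_points eq_q eg /D /tau; ring.
have := @plucker _ _ (fun i j => w i ^+ e j) n_gt0 (fun j => a ^+ e j)
  (fun j => b ^+ e j) (fun j => c ^+ e j) (fun j => x ^+ e j).
rewrite !br => H.
have nz : g ^+ 2 * tau a * tau b * tau c * tau x != 0.
  by rewrite !mulf_neq0 ?expf_neq0 ?tau0.
apply: (mulfI nz); rewrite mulr0 -[RHS]H; ring.
Qed.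

Lemma plucker_quotient_hom (S : idomainType) (f : {rmorphism R -> S})
    (e : 'I_n.+1 -> nat) (q : R -> R -> R) (Q : S -> S -> S) (pts : seq R) :
  injective w -> {in pts, forall x i, w i != x} ->
  (forall a b, alt e (two_points w a b) = alt (@rho n.+1) (two_points w a b) * q a b) ->
  (forall a b, f (q a b) = Q (f a) (f b)) ->
  forall a b c x, a \in pts -> b \in pts -> c \in pts -> x \in pts ->
  let D s t := (s - t) * Q s t in
  D (f a) (f b) * D (f c) (f x) - D (f a) (f c) * D (f b) (f x)
    + D (f a) (f x) * D (f b) (f c) = 0.
Proof.
move=> winj wpts eq_q fq a b c x ap bp cp xp D.
have fD s t : f ((s - t) * q s t) = D (f s) (f t) by rewrite rmorphM rmorphB fq.
rewrite -!fD -!rmorphM -rmorphB -rmorphD.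
by rewrite (plucker_quotient winj wpts eq_q ap bp cp xp) rmorph0.
Qed.

End TwoPoints.

Definition is_quotient (K : fieldType) (n : nat) (e : 'I_n -> nat) (C : {mpoly K[n]}) :=
  alt e (fun i => 'X_i : {mpoly K[n]}) = alt (@rho n) (fun i => 'X_i) * C.

Section Quotient.
Variables (K : fieldType) (n : nat) (e : 'I_n -> nat) (C : {mpoly K[n]}).
Hypothesis HC : is_quotient e C.

Lemma quotient_hom (R : comNzRingType) (f : {rmorphism K -> R}) (h : 'I_n -> R) :
  alt e h = alt (@rho n) h * mmap f h C.
Proof.
have hX : mmap f h \o (fun i => 'X_i) =1 h by move=> i /=; rewrite mmapX mmap1U.
rewrite -(eq_alt (fun=> erefl) hX) -[alt (@rho n) h](eq_alt (fun=> erefl) hX).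
by rewrite -!rmorph_alt -rmorphM HC.
Qed.

Lemma quotient_eval v : alt e v = alt (@rho n) v * C.@[v].
Proof. exact: (quotient_hom idfun). Qed.

Lemma quotient_sym s : msym s C = C.
Proof.
have := quotient_hom (@mpolyC n K) ((fun i => 'X_i) \o s).
rewrite !alt_perm -mulrA => /(mulfI (negbT (signr_eq0 _ _))); rewrite HC.
by move/(mulfI (alt_rho_neq0 (@mpolyX_inj _ _))).
Qed.

End Quotient.

Lemma meval_mmap (R : comNzRingType) (n m : nat) (h : 'I_n -> {mpoly R[m]}) p u :
  (mmap (@mpolyC m R) h p).@[u] = p.@[fun i => (h i).@[u]].
Proof.
apply: (@mpoly_hom_ext _ _ _ (meval u \o mmap (@mpolyC m R) h)
  (meval (fun i => (h i).@[u]))) => [c|i] /=.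
  by rewrite mmapC !mevalC.
by rewrite mmapX mmap1U mevalXU.
Qed.

Lemma quotient_plucker (K : fieldType) (n : nat) (e : 'I_n.+1 -> nat)
    (C : {mpoly K[n.+1]}) (w : 'I_n.+1 -> K) : (0 < n)%N -> is_quotient e C ->
  let D s t := (s - t) * C.@[two_points w s t] in
  forall a b c x, D a b * D c x - D a c * D b x + D a x * D b c = 0.
Proof.
move=> n_gt0 HC D a b c x.
pose R := {mpoly K[n.+1 + 4]}.
pose W (i : 'I_n.+1) : R := 'X_(lshift 4 i).
pose P (k : 'I_4) : R := 'X_(rshift n.+1 k).
pose q s t : R := mmap (@mpolyC _ K) (two_points W s t) C.
pose u (i : 'I_(n.+1 + 4)) := match split i with
  | inl i => w i | inr k => [:: a; b; c; x]`_k end.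
have winj : injective W.
  by move=> i j /mpolyX_inj e0; apply/val_inj; have /(congr1 val) := e0.
have wpts : {in [seq P k | k : 'I_4], forall y i, W i != y}.
  move=> y /mapP[k _ ->] i; apply/eqP => /mpolyX_inj/(congr1 val) /= e0.
  by have := ltn_ord i; rewrite e0 ltnNge leq_addr.
have pin k : P k \in [seq P k | k : 'I_4] by apply: map_f; rewrite mem_enum.
have eq_q s t : alt e (two_points W s t) = alt (@rho n.+1) (two_points W s t) * q s t.
  exact: quotient_hom.
have uP k : (P k).@[u] = [:: a; b; c; x]`_k by rewrite mevalXU /u -[rshift _ _]/(unsplit (inr k)) unsplitK.
have uW i : (W i).@[u] = w i by rewrite mevalXU /u -[lshift _ _]/(unsplit (inl i)) unsplitK.
have uq s t : (q s t).@[u] = C.@[two_points w s.@[u] t.@[u]].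
  rewrite /q meval_mmap; apply: meval_eq => i.
  by rewrite /two_points; do 2?case: eqP => // _.
have := plucker_quotient_hom n_gt0 (f := meval u)
  (Q := fun s t => C.@[two_points w s t]) winj wpts eq_q uq
  (pin (@Ordinal 4 0 isT)) (pin (@Ordinal 4 1 isT)) (pin (@Ordinal 4 2 isT))
  (pin (@Ordinal 4 3 isT)).
by rewrite /= !uP.
Qed.

(** * A sparse polynomial with a single multiple root *)

Section Multiple.
Variable K : closedFieldType.
Hypothesis K0 : [pchar K] =i pred0.
Implicit Types p q : {poly K}.

Definition multiple_root p x := p.[x] = 0 /\ p^`().[x] = 0.

Definition separated p := forall x, ~ multiple_root p x.

Lemma natK_neq0 k : (0 < k)%N -> (k%:R : K) != 0.
Proof. by move=> k_gt0; have /pcharf0P -> := K0; rewrite -lt0n. Qed.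

Lemma deriv_eq0 p : p^`() = 0 -> exists c, p = c%:P.
Proof.
move=> d0; exists p`_0; apply/polyP => i; rewrite coefC; case: i => //= i.
have := congr1 (fun q => q`_i) d0; rewrite coef_deriv coef0 -mulr_natr => /eqP.
by rewrite mulf_eq0 (negbTE (natK_neq0 _)) // orbF => /eqP.
Qed.

Lemma wronskian_eq0 p q : q != 0 -> p^`() * q = p * q^`() -> exists c, p = c *: q.
Proof.
move=> q0 W; set g := gcdp p q.
have g0 : g != 0 by rewrite gcdp_eq0 negb_and q0 orbT.
have [p1 ep] : exists p1, p = p1 * g by apply/dvdpP/dvdp_gcdl.
have [q1 eq] : exists q1, q = q1 * g by apply/dvdpP/dvdp_gcdr.
have q10 : q1 != 0 by apply: contraNneq q0 => e; rewrite eq e mul0r.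
have cop : coprimep q1 p1.
  have := @coprimep_div_gcd _ p q; rewrite q0 orbT => /(_ isT).
  by rewrite -/g {1}ep {1}eq !mulpK // coprimep_sym.
have W1 : p1^`() * q1 = p1 * q1^`().
  apply: (mulfI (expf_neq0 2 g0)); move: W; rewrite ep eq !derivM.
  move=> W; have -> : g ^+ 2 * (p1^`() * q1) =
     (p1^`() * g + p1 * g^`()) * (q1 * g) - p1 * g^`() * q1 * g by ring.
  by rewrite W; ring.
have dq : q1^`() = 0.
  have : q1 %| q1^`() by rewrite -(Gauss_dvdpr _ cop) -W1 dvdp_mull.
  move/dvdp_leq; case: eqP => // /eqP d0 /(_ isT).
  by rewrite leqNgt lt_size_deriv.
have dp : p1^`() = 0.
  by move/eqP: W1; rewrite dq mulr0 mulf_eq0 (negbTE q10) orbF => /eqP.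
have [c1 e1] := deriv_eq0 dp; have [c2 e2] := deriv_eq0 dq.
have c20 : c2 != 0 by apply: contraNneq q10 => e; rewrite e2 e.
exists (c1 / c2); rewrite ep eq e1 e2 -!mul_polyC mulrA -polyCM divfK //.
Qed.

(* A multiple root of [p + g q] is a root of the Wronskian of [p] and [q], so away
   from common multiple roots each of the finitely many candidates excludes one [g]. *)
Lemma generic_pencil p q : exists2 B : {poly K}, B != 0 & forall g, B.[g] != 0 ->
  forall x, multiple_root (p + g *: q) x -> multiple_root p x /\ multiple_root q x.
Proof.
have [->|q0] := eqVneq q 0.
  exists 1; first exact: oner_neq0.
  by move=> g _ x; rewrite scaler0 addr0 /multiple_root deriv0 horner0.
have [W0|W0] := eqVneq (p^`() * q - p * q^`()) 0.
  have [c ep] : exists c, p = c *: q by apply: wronskian_eq0 => //; apply/eqP; rewrite -subr_eq0 W0.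
  exists ('X + c%:P); first by rewrite -size_poly_eq0 size_XaddC.
  move=> g; rewrite !hornerE => gc x; rewrite ep -scalerDl addrC /multiple_root.
  rewrite !derivZ !hornerZ => -[/eqP + /eqP].
  by rewrite !mulf_eq0 (negbTE gc) /= => /eqP -> /eqP ->; rewrite !mulr0.
pose W := p^`() * q - p * q^`(); rewrite -/W in W0.
have [rs eW] := closed_field_poly_normal W.
pose h x : K := if q.[x] != 0 then - p.[x] / q.[x] else - p^`().[x] / q^`().[x].
exists (\prod_(x <- rs) ('X - (h x)%:P)).
  by rewrite monic_neq0 // monic_prod_XsubC.
move=> g Bg x [r1 r2].
move: r1 r2; rewrite derivD derivZ !hornerD !hornerZ => r1 r2.
have p1 : p.[x] = - (g * q.[x]) by apply/eqP; rewrite -addr_eq0 r1.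
have p2 : p^`().[x] = - (g * q^`().[x]) by apply/eqP; rewrite -addr_eq0 r2.
have xrs : x \in rs.
  have : W.[x] == 0 by rewrite /W !hornerE p1 p2; apply/eqP; ring.
  rewrite eW hornerZ mulf_eq0 lead_coef_eq0 (negbTE W0) /=.
  by have := root_prod_XsubC rs x; rewrite /root => ->.
have gh : g != h x.
  apply: contraNneq Bg => ->; rewrite horner_prod; apply/eqP.
  by apply/eqP; rewrite (perm_big _ (perm_to_rem xrs)) big_cons /= hornerXsubC subrr mul0r.
have [q1|q1] := eqVneq q.[x] 0; last first.
  by case/eqP: gh; rewrite /h q1 p1 opprK mulfK.
have [q2|q2] := eqVneq q^`().[x] 0; last first.
  by case/eqP: gh; rewrite /h q1 eqxx p2 opprK mulfK.
by rewrite /multiple_root p1 p2 q1 q2 mulr0 oppr0.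
Qed.

End Multiple.

Definition sparse (K : nzRingType) (r : nat) (e : 'I_r -> nat) (c : 'I_r -> K) : {poly K} :=
  \sum_j c j *: 'X^(e j).

Lemma decreasing_inj (n : nat) (e : 'I_n -> nat) :
  (forall i j : 'I_n, (i < j)%N -> (e j < e i)%N) -> injective e.
Proof.
move=> e_decr i j eij; apply/val_inj/eqP; rewrite eqn_leq; apply/andP; split; rewrite leqNgt;
  by apply/negP => /e_decr; rewrite eij ltnn.
Qed.

Section Sparse.
Variables (K : closedFieldType) (n : nat) (e : 'I_n.+3 -> nat).
Hypothesis K0 : [pchar K] =i pred0.
Hypothesis e_decr : forall i j : 'I_n.+3, (i < j)%N -> (e j < e i)%N.
Hypothesis e_max : e ord_max = 0%N.
Hypothesis e_gcd : \big[gcdn/0%N]_i e i = 1%N.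
Implicit Types c : 'I_n.+3 -> K.

Lemma horner_sparse c x : (sparse e c).[x] = \sum_j c j * x ^+ e j.
Proof.
by rewrite /sparse horner_sum; apply: eq_bigr => j _; rewrite hornerZ hornerXn.
Qed.

Lemma sparse_lin c1 c2 g :
  sparse e c1 + g *: sparse e c2 = sparse e (fun j => c1 j + g * c2 j).
Proof.
rewrite /sparse scaler_sumr -big_split; apply: eq_bigr => j _ /=.
by rewrite scalerA scalerDl.
Qed.

Lemma coef_sparse c j : (sparse e c)`_(e j) = c j.
Proof.
rewrite /sparse coef_sum (bigD1 j) //= coefZ coefXn eqxx mulr1 big1 ?addr0 // => i ij.
by rewrite coefZ coefXn (inj_eq (decreasing_inj e_decr)) eq_sym (negbTE ij) mulr0.
Qed.

Lemma size_sparse_le c : (size (sparse e c) <= (e ord0).+1)%N.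
Proof.
apply: leq_trans (size_sum _ _ _) _; apply/bigmax_leqP => j _.
apply: leq_trans (size_scale_leq _ _) _; rewrite size_polyXn ltnS.
have [->//|j0] := eqVneq j ord0; apply/ltnW/e_decr.
by rewrite lt0n -val_eqE in j0 *.
Qed.

Lemma size_sparse c : c ord0 != 0 -> size (sparse e c) = (e ord0).+1.
Proof.
move=> c0; apply/eqP; rewrite eqn_leq size_sparse_le /=.
by apply: contraNltn c0 => /leq_sizeP/(_ _ (leqnn _)); rewrite coef_sparse => ->.
Qed.

(* [tri k] is the combination of [X^(e 0)], [X^(e k)] and [1] with a double root at 1. *)
Let tri (k j : 'I_n.+3) : K :=
  if j == ord0 then (e k)%:R else if j == k then - (e ord0)%:R
  else if j == ord_max then (e ord0)%:R - (e k)%:R else 0.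

Let is_mid (k : 'I_n.+3) := (k != ord0) && (k != ord_max).

Lemma sparse_tri k : is_mid k -> sparse e (tri k) =
  (e k)%:R *: 'X^(e ord0) - (e ord0)%:R *: 'X^(e k) + ((e ord0)%:R - (e k)%:R)%:P.
Proof.
move=> /andP[k0 km]; rewrite /sparse (bigD1 ord0) //= (bigD1 k) //= (bigD1 ord_max) //=; last first.
  by rewrite eq_sym.
rewrite big1 ?addr0 => [|j /andP[/andP[j0 jk] jm]]; last first.
  by rewrite /tri (negbTE j0) (negbTE jk) (negbTE jm) scale0r.
by rewrite /tri !eqxx (negbTE k0) (eq_sym _ k) (negbTE km) e_max expr0 alg_polyC scaleNr addrA.
Qed.

Let exists_sparse_aux (s : seq 'I_n.+3) : s != [::] -> all is_mid s ->
  exists c, [/\ (sparse e c).[1] = 0, (sparse e c)^`().[1] = 0,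
    (sparse e c)^`()^`().[1] != 0, c ord0 != 0 /\ c ord_max != 0 &
    forall x, multiple_root (sparse e c) x ->
      {in s, forall k, multiple_root (sparse e (tri k)) x}].
Proof.
have m0 : (ord_max == ord0 :> 'I_n.+3) = false by [].
have tri1 k : is_mid k -> [/\ (sparse e (tri k)).[1] = 0, (sparse e (tri k))^`().[1] = 0,
    (sparse e (tri k))^`()^`().[1] != 0 & tri k ord0 != 0 /\ tri k ord_max != 0].
  move=> mk; have /andP[k0 km] := mk.
  have lt1 : (e k < e ord0)%N by apply: e_decr; rewrite lt0n -val_eqE in k0 *.
  have lt2 : (0 < e k)%N.
    by rewrite -e_max; apply: e_decr; rewrite ltn_neqAle -val_eqE in km *; rewrite km -ltnS ltn_ord.
  rewrite sparse_tri // !(derivD, derivN, derivZ, derivXn, derivC, derivMn).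
  rewrite !(hornerD, hornerN, hornerZ, hornerXn, hornerC, hornerMn, derivMn, derivXn) !expr1n.
  split.
  - by ring.
  - by rewrite addr0; ring.
  - have pr y : (0 < y)%N -> y.-1%:R = y%:R - 1 :> K by case: y => // y _; rewrite mulrSr addrK.
    have -> : (e k)%:R * ((e ord0).-1%:R *+ e ord0) - (e ord0)%:R * ((e k).-1%:R *+ e k) + 0
        = (e k)%:R * (e ord0)%:R * ((e ord0)%:R - (e k)%:R) :> K.
      rewrite -[(e ord0).-1%:R *+ _]mulr_natr -[(e k).-1%:R *+ _]mulr_natr.
      by rewrite (pr _ lt2) (pr _ (ltn_trans lt2 lt1)); ring.
    by rewrite !mulf_neq0 -?natrB ?(ltnW lt1) // !(natK_neq0 K0) ?subn_gt0 // (leq_trans _ lt1).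
  - rewrite /tri eqxx m0 (eq_sym _ k) (negbTE km) eqxx.
    rewrite -natrB ?(ltnW lt1) // !(natK_neq0 K0) ?subn_gt0 //.
elim: s => // k s IH _ /= /andP[mk ms].
have [t1 t2 t3 [t4 t5]] := tri1 k mk.
have [->|s0] := eqVneq s [::].
  by exists (tri k); split=> // x mx j; rewrite inE => /eqP ->.
have [c [c1 c2 c3 [c4 c5] cm]] := IH s0 ms.
have [B B0 HB] := generic_pencil K0 (sparse e c) (sparse e (tri k)).
pose L (a b : K) : {poly K} := b *: 'X + a%:P.
have L0 a b : b != 0 -> L a b != 0.
  move=> b0; apply/eqP => /(congr1 (fun p : {poly K} => p`_1)) /eqP.
  by rewrite coefD coefZ coefX coefC mulr1 addr0 coef0 (negbTE b0).
have P0 : B * L (sparse e c)^`()^`().[1] (sparse e (tri k))^`()^`().[1]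
  * L (c ord0) (tri k ord0) * L (c ord_max) (tri k ord_max) != 0.
  by rewrite !mulf_neq0 ?L0.
have [g] := exists_nonroot P0.
rewrite !hornerM !mulf_eq0 !negb_or /L !hornerD !hornerZ !hornerX !hornerC.
rewrite ![_ * g]mulrC ![g * _ + _]addrC => /andP[/andP[/andP[Bg g3] g4] g5].
exists (fun j => c j + g * tri k j); rewrite -sparse_lin; split=> //.
- by rewrite hornerD hornerZ c1 t1; ring.
- by rewrite derivD derivZ hornerD hornerZ c2 t2; ring.
- by rewrite !derivD !derivZ hornerD hornerZ.
- move=> x /(HB g Bg)[/cm mc mt] j; rewrite inE => /orP[/eqP -> //|].
  exact: mc.
Qed.

Lemma exists_good_sparse : exists c, [/\ (sparse e c).[1] = 0, (sparse e c)^`().[1] = 0,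
    (sparse e c)^`()^`().[1] != 0, c ord0 != 0 /\ c ord_max != 0 &
    forall x, multiple_root (sparse e c) x -> x = 1].
Proof.
have [||c [c1 c2 c3 c4 cm]] := @exists_sparse_aux (enum is_mid).
- apply/eqP => e0; have : @Ordinal n.+3 1 isT \in enum is_mid by rewrite mem_enum.
  by rewrite e0.
- by apply/allP => k; rewrite mem_enum.
exists c; split=> // x mx; have {cm} cm k : is_mid k -> multiple_root (sparse e (tri k)) x.
  by move=> mk; apply: (cm x mx); rewrite mem_enum.
have p1 k : is_mid k -> x ^+ e k = 1 /\ x ^+ e ord0 = 1.
  move=> mk; have /andP[k0 km] := mk.
  have lt1 : (e k < e ord0)%N by apply: e_decr; rewrite lt0n -val_eqE in k0 *.
  have lt2 : (0 < e k)%N.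
    by rewrite -e_max; apply: e_decr; rewrite ltn_neqAle -val_eqE in km *; rewrite km -ltnS ltn_ord.
  have [] := cm k mk; rewrite sparse_tri // !(derivD, derivN, derivZ, derivXn, derivC).
  rewrite !(hornerD, hornerN, hornerZ, hornerXn, hornerC, hornerMn) addr0 => h1 h2.
  have ex y : (0 < y)%N -> x ^+ y = x * x ^+ y.-1 by case: y => // y _; rewrite exprS.
  have E : x ^+ e ord0 = x ^+ e k.
    have nz : (e k)%:R * (e ord0)%:R != 0 :> K by rewrite mulf_neq0 ?natK_neq0 // (leq_trans _ lt1).
    apply: (mulfI nz); apply/eqP; rewrite -subr_eq0 (ex (e ord0)) ?(leq_trans _ lt1) // (ex (e k)) //.
    rewrite -(mulr0 x) -h2 -[x ^+ (e ord0).-1 *+ _]mulr_natr -[x ^+ (e k).-1 *+ _]mulr_natr.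
    by apply/eqP; ring.
  have nz : (e ord0)%:R - (e k)%:R != 0 :> K by rewrite -natrB ?natK_neq0 ?subn_gt0 // ltnW.
  have E1 : x ^+ e k = 1.
    by apply: (mulfI nz); apply/eqP; rewrite -subr_eq0 -oppr_eq0 -h1 E; apply/eqP; ring.
  by rewrite E E1.
have m1 : is_mid (@Ordinal n.+3 1 isT) by [].
have all1 j : x ^+ e j = 1.
  have [->|j0] := eqVneq j ord0; first by have [_] := p1 _ m1.
  have [->|jm] := eqVneq j ord_max; first by rewrite e_max expr0.
  by have [] := p1 j; rewrite ?/is_mid ?j0 ?jm.
suff : x ^+ (\big[gcdn/0%N]_i e i) = 1 by rewrite e_gcd expr1.
apply: (big_ind (fun a => x ^+ a = 1)) => [|a b xa xb|j _]; rewrite ?expr0 //.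
have [a0|a0] := posnP a; first by rewrite a0 gcd0n.
case: (egcdnP b a0) => km kn e1 _.
have : x ^+ (km * a) = 1 by rewrite mulnC exprM xa expr1n.
by rewrite e1 exprD mulnC exprM xb expr1n mul1r.
Qed.

End Sparse.

(** * A specialization with simple roots *)

Definition upd (T : Type) (n : nat) (u : 'I_n -> T) (i : 'I_n) (y : T) : 'I_n -> T :=
  fun k => if k == i then y else u k.

Section PolyLemmas.
Variable K : closedFieldType.
Implicit Types p q : {poly K}.

Lemma poly_eq_horner p q : (forall y, p.[y] = q.[y]) -> p = q.
Proof.
move=> pq; apply/eqP; rewrite -subr_eq0; apply: contraT => /exists_nonroot[y].
by rewrite hornerD hornerN pq subrr eqxx.
Qed.

Lemma multiple_rootP p x : multiple_root p x <-> exists q, p = q * ('X - x%:P) ^+ 2.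
Proof.
split=> [[p0 dp0]|[q ->]]; last first.
  rewrite expr2; split; first by rewrite !hornerM hornerXsubC subrr !mulr0.
  by rewrite !derivM derivXsubC !(hornerXsubC, hornerD, hornerM, subrr, mulr0, mul0r, addr0).
have [q e] : exists q, p = q * ('X - x%:P) by apply/factor_theorem/rootP.
have q0 : root q x.
  move: dp0; rewrite e derivM derivXsubC hornerD !hornerM hornerXsubC hornerC.
  by rewrite subrr mulr0 add0r mulr1 => /rootP.
have [q1 e1] : exists q1, q = q1 * ('X - x%:P) by apply/factor_theorem.
by exists q1; rewrite e e1 expr2 mulrA.
Qed.

Lemma multiple_root_mulr p q x : multiple_root p x -> multiple_root (p * q) x.
Proof.
by case=> p0 dp0; split; rewrite ?derivM ?hornerD !hornerM p0 ?dp0 !mul0r ?addr0.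
Qed.

Lemma separated_divp p q : p != 0 -> separated p ->
  (forall x, p.[x] = 0 -> q.[x] = 0) -> p %| q.
Proof.
move=> p0 sp pq; have [rs e] := closed_field_poly_normal p.
have urs : uniq rs.
  apply: contraT => /(uniqPn 0)[i [j [ij js xx]]]; case: (sp rs`_i).
  apply/multiple_rootP.
  have [s1 [s2 [s3 er]]] : exists s1 s2 s3, rs = s1 ++ rs`_i :: s2 ++ rs`_j :: s3.
    exists (take i rs), (take (j - i.+1) (drop i.+1 rs)), (drop j.+1 rs).
    have dj : drop j rs = drop (j - i.+1) (drop i.+1 rs) by rewrite drop_drop subnK.
    rewrite -(drop_nth 0 js) dj cat_take_drop.
    by rewrite -drop_nth ?(ltn_trans ij) // cat_take_drop.
  rewrite -xx in er.
  exists (lead_coef p *: (\prod_(z <- s1 ++ s2 ++ s3) ('X - z%:P))).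
  by rewrite {1}e {1}er !(big_cat, big_cons) /= -!scalerAl; congr (_ *: _); ring.
rewrite e dvdpZl ?lead_coef_eq0 //; apply: uniq_roots_dvdp; last by rewrite uniq_rootsE.
apply/allP => z zrs; apply/rootP/pq; rewrite e hornerZ.
by have := root_prod_XsubC rs z; rewrite zrs => /rootP ->; rewrite mulr0.
Qed.

End PolyLemmas.

Section SparseDivision.
Variables (K : closedFieldType) (n : nat) (e : 'I_n.+3 -> nat).
Hypothesis e_decr : forall i j : 'I_n.+3, (i < j)%N -> (e j < e i)%N.
Implicit Types c : 'I_n.+3 -> K.

Lemma sparse_proportional c f :
  multiple_root (sparse e c) 1 -> (sparse e c)^`()^`().[1] != 0 ->
  (forall x, multiple_root (sparse e c) x -> x = 1) -> c ord0 != 0 ->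
  multiple_root (sparse e f) 1 ->
  (forall x, (sparse e c).[x] = 0 -> (sparse e f).[x] = 0) ->
  exists g, forall j, f j = g * c j.
Proof.
move=> /multiple_rootP[S eS] d2 only1 c0 /multiple_rootP[Q eQ] roots.
have sz := size_sparse e_decr c0.
have T0 : sparse e c != 0 by rewrite -size_poly_eq0 sz.
have S1 : S.[1] != 0.
  apply: contraNneq d2 => S1; rewrite eS expr2 !(derivM, derivD, derivXsubC, derivC).
  by rewrite !(hornerXsubC, hornerD, hornerM, hornerC, S1, subrr, mulr0, mul0r, addr0).
have S0 : S != 0 by apply: contraNneq S1 => ->; rewrite horner0.
have dSQ : S %| Q.
  apply: separated_divp => // [x mx|x Sx].
    have x1 : x = 1 by apply: only1; rewrite eS; apply: multiple_root_mulr.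
    by case: mx; rewrite x1 => /eqP; rewrite (negbTE S1).
  have x1 : x - 1 != 0.
    by rewrite subr_eq0; apply: contraNneq S1 => <-; rewrite Sx.
  have : (sparse e f).[x] = 0 by apply: roots; rewrite eS hornerM Sx mul0r.
  rewrite eQ hornerM horner_exp hornerXsubC => /eqP.
  by rewrite mulf_eq0 expf_eq0 /= (negbTE x1) orbF => /eqP.
have [q eq] : exists q, sparse e f = q * sparse e c.
  by apply/dvdpP; rewrite eQ eS dvdp_mul.
have sq : (size q <= 1)%N.
  have [->|q0] := eqVneq q 0; first by rewrite size_poly0.
  have := size_sparse_le e_decr f; rewrite eq size_mul // sz addnS /=.
  by rewrite -[X in (_ <= X)%N -> _]add1n leq_add2r.
exists q`_0 => j; rewrite -(coef_sparse e_decr f) eq (size1_polyC sq) coefCM.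
by rewrite coef_sparse // coefC.
Qed.

End SparseDivision.

Lemma deriv_sparse1 (R : comNzRingType) (r : nat) (e : 'I_r -> nat) (c : 'I_r -> R) :
  (sparse e c)^`().[1] = \sum_j (e j)%:R * c j.
Proof.
rewrite /sparse raddf_sum horner_sum; apply: eq_bigr => j _ /=.
by rewrite derivZ derivXn hornerZ hornerMn hornerXn expr1n mulrC.
Qed.

Section Confluent.
Variables (R : comNzRingType) (r : nat) (i1 : 'I_r).
Implicit Types (e : 'I_r -> nat) (u : 'I_r -> R).

(* The derivative at 1 of an alternant in its variable [i1]. *)
Definition confluent e u : 'M[R]_r :=
  \matrix_(i, j) if i == i1 then (e j)%:R else u i ^+ e j.

Lemma sum_row_cofactor (A : 'M[R]_r) i k :
  \sum_j A i j * cofactor A k j = (i == k)%:R * \det A.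
Proof.
have /matrixP/(_ i k) := mul_mx_adj A; rewrite !mxE => e.
rewrite mulr_natl -e; apply: eq_bigr => j _; by rewrite !mxE.
Qed.

Lemma eq_cofactor (A B : 'M[R]_r) i j :
  (forall k l, k != i -> A k l = B k l) -> cofactor A i j = cofactor B i j.
Proof.
move=> AB; congr (_ * \det _); apply/matrixP => k l; rewrite !mxE.
by apply: AB; rewrite eq_sym neq_lift.
Qed.

Lemma alt_upd e u i y : alt e (upd u i y) =
  (sparse e (fun j => cofactor (\matrix_(k, j) u k ^+ e j) i j)).[y].
Proof.
rewrite /alt (expand_det_row _ i) horner_sum; apply: eq_bigr => j _.
rewrite hornerZ hornerXn mulrC !mxE /upd eqxx; congr (_ * _).
by apply: eq_cofactor => k l ki; rewrite !mxE (negbTE ki).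
Qed.

Lemma det_confluent e u : \det (confluent e u) =
  (sparse e (fun j => cofactor (\matrix_(k, j) u k ^+ e j) i1 j))^`().[1].
Proof.
rewrite deriv_sparse1 (expand_det_row _ i1); apply: eq_bigr => j _.
rewrite mxE eqxx; congr (_ * _).
by apply: eq_cofactor => k l ki; rewrite !mxE (negbTE ki).
Qed.

Lemma det_confluent_upd e u i y : i != i1 -> \det (confluent e (upd u i y)) =
  (sparse e (cofactor (confluent e u) i)).[y].
Proof.
move=> ii; rewrite (expand_det_row _ i) horner_sum; apply: eq_bigr => j _.
rewrite hornerZ hornerXn mulrC !mxE /upd eqxx (negbTE ii); congr (_ * _).
by apply: eq_cofactor => k l ki; rewrite !mxE (negbTE ki).
Qed.

End Confluent.

Section ConfluentQuotient.
Variables (K : closedFieldType) (n : nat) (e : 'I_n -> nat) (C : {mpoly K[n]}).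
Hypothesis HC : is_quotient e C.

Lemma det_confluent_quotient (i0 i1 : 'I_n) u : i0 != i1 -> u i0 = 1 -> u i1 = 1 ->
  \det (confluent i1 e u) = \det (confluent i1 (@rho n) u) * C.@[u].
Proof.
move=> i01 u0 u1.
pose L := mmap (@polyC K) (fun k => if k == i1 then 'X else (u k)%:P) C.
have LE y : L.[y] = C.@[upd u i1 y].
  apply: (@mpoly_hom_ext _ _ _ (horner_eval y \o
    mmap (@polyC K) (fun k => if k == i1 then 'X else (u k)%:P)) (meval (upd u i1 y))) => [c|i] /=.
    by rewrite mmapC /horner_eval hornerC mevalC.
  rewrite mmapX mmap1U mevalXU /horner_eval /upd.
  by case: eqP => _; rewrite ?hornerX ?hornerC.
pose A f := sparse f (fun j => cofactor (\matrix_(k, j) u k ^+ f j) i1 j).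
have eA : A e = A (@rho n) * L.
  apply: poly_eq_horner => y; rewrite hornerM -!alt_upd LE.
  exact: (quotient_eval HC).
rewrite !det_confluent -/(A e) -/(A (@rho n)) eA derivM hornerD !hornerM.
have -> : (A (@rho n)).[1] = 0.
  rewrite -alt_upd; apply: (alt_repeat _ i01).
  by rewrite /upd (negbTE i01) eqxx.
rewrite mul0r addr0 LE; congr (_ * _); apply: meval_eq => k.
by rewrite /upd; case: eqP => // ->.
Qed.

End ConfluentQuotient.

Section SpecialPoint.
Variables (K : closedFieldType) (n : nat) (e : 'I_n.+3 -> nat).
Hypothesis K0 : [pchar K] =i pred0.
Hypothesis e_decr : forall i j : 'I_n.+3, (i < j)%N -> (e j < e i)%N.
Hypothesis e_max : e ord_max = 0%N.
Hypothesis e_gcd : \big[gcdn/0%N]_i e i = 1%N.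

Let i1 : 'I_n.+3 := @Ordinal n.+3 1 isT.

Lemma pow0_e j : (0 : K) ^+ e j = (j == ord_max)%:R.
Proof.
have [->|jm] := eqVneq j ord_max; first by rewrite e_max expr0.
have lt0 : (0 < e j)%N.
  rewrite -[X in (X < _)%N]e_max; apply: e_decr; move: jm; rewrite -val_eqE /= => jm.
  by rewrite ltn_neqAle jm -ltnS ltn_ord.
by rewrite expr0n eqn0Ngt lt0.
Qed.

Section Exchange.
Variable c : 'I_n.+3 -> K.
Hypothesis c1 : multiple_root (sparse e c) 1.
Hypothesis c2 : (sparse e c)^`()^`().[1] != 0.
Hypothesis c_only1 : forall x, multiple_root (sparse e c) x -> x = 1.
Hypothesis c_0 : c ord0 != 0.
Hypothesis c_max : c ord_max != 0.

Let rows (k : nat) (u : 'I_n.+3 -> K) : 'M[K]_n.+3 := \matrix_(i, j)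
  if i == i1 then (e j)%:R
  else if (i == ord0) || (i == ord_max) || (i < k)%N then u i ^+ e j else (i == j)%:R.

Lemma rows_start : \det (rows 0 (upd (fun=> 1) ord_max 0)) != 0.
Proof.
rewrite -det_tr; apply/det0P => -[x x0] /rowP xA.
have E i : \sum_j x 0 j * rows 0 (upd (fun=> 1) ord_max 0) i j = 0.
  have := xA i; rewrite !mxE => H; rewrite -[RHS]H.
  by apply: eq_bigr => j _; rewrite [in RHS]mxE.
have xi i : i != ord0 -> i != i1 -> x 0 i = 0.
  move=> i0 ii; have := E i; rewrite (bigD1 i) //= big1 => [|j ji].
    rewrite !mxE (negbTE ii) (negbTE i0) /= ltn0 orbF /upd.
    by case: eqP => [->|_]; rewrite ?pow0_e eqxx mulr1 addr0.
  rewrite !mxE (negbTE ii) (negbTE i0) /= ltn0 orbF /upd.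
  case: eqP => [im|_]; first by rewrite pow0_e -im (negbTE ji) mulr0.
  by rewrite eq_sym (negbTE ji) mulr0.
have E2 f : \sum_j x 0 j * f j = x 0 ord0 * f ord0 + x 0 i1 * f i1.
  rewrite (bigD1 ord0) //= (bigD1 i1) //= big1 ?addr0 // => j /andP[j0 j1].
  by rewrite xi // mul0r.
have := E ord0; rewrite E2 !mxE /= /upd /= !expr1n !mulr1 => s0.
have := E i1; rewrite E2 !mxE eqxx => s1.
have x1 : x 0 ord0 = - x 0 i1 by apply/eqP; rewrite -addr_eq0 s0.
have d0 : (e ord0)%:R - (e i1)%:R != 0 :> K.
  have lt1 : (e i1 < e ord0)%N by apply: e_decr.
  by rewrite -natrB ?(natK_neq0 K0) ?subn_gt0 // ltnW.
have x10 : x 0 i1 = 0.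
  by apply: (mulIf d0); rewrite mul0r -[RHS]oppr0 -s1 x1; ring.
case/eqP: x0; apply/rowP => j; rewrite mxE.
have [->|j0] := eqVneq j ord0; first by rewrite x1 x10 oppr0.
by have [->|j1] := eqVneq j i1; rewrite ?x10 // xi.
Qed.

(* Exchange the unit row of index [k] for the powers of a root: the cofactors of that
   row are not proportional to [c] because they annihilate the last row. *)
Lemma rows_step k : (k <= n.+2)%N -> exists u, [/\ u ord0 = 1, u i1 = 1, u ord_max = 0,
  forall i, i != ord_max -> (sparse e c).[u i] = 0 & \det (rows k u) != 0].
Proof.
elim: k => [_|k IH lt_k].
  exists (upd (fun=> 1) ord_max 0); split=> //; last exact: rows_start.
    by rewrite /upd eqxx.
  by move=> i im; rewrite /upd (negbTE im); case: c1.
have [u [u0 u1 um uT d0]] := IH (ltnW lt_k).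
pose i := @Ordinal n.+3 k (ltn_trans lt_k (ltnSn _)).
have im : i != ord_max by rewrite -val_eqE /= ltn_eqF.
have rowsE (w : 'I_n.+3 -> K) l j : l != i -> (forall l, l != i -> w l = u l) ->
    rows k.+1 w l j = rows k u l j.
  move=> li wu; rewrite !mxE wu //; case: eqP => // _; case: eqP => // _; case: eqP => //= _.
  by rewrite ltnS leq_eqVlt -val_eqE /= in li *; rewrite (negbTE li).
have [i01|i01] := boolP ((i == ord0) || (i == i1)).
  exists u; split=> //; suff -> : rows k.+1 u = rows k u by [].
  apply/matrixP => l j; have [->|li] := eqVneq l i; last exact: rowsE.
  by rewrite !mxE; case/orP: i01 => /eqP ->.
move: i01; rewrite negb_or => /andP[i0 ii].
pose f := cofactor (rows k u) i.
have kill l : l != i -> \sum_j rows k u l j * f j = 0.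
  by move=> li; rewrite sum_row_cofactor (negbTE li) mul0r.
have [x [Tx fx]] : exists x, (sparse e c).[x] = 0 /\ (sparse e f).[x] != 0.
  apply: NNPP => no.
  have roots x : (sparse e c).[x] = 0 -> (sparse e f).[x] = 0.
    by move=> Tx; apply/eqP; apply: contraT => fx; case: no; exists x.
  have m1 : multiple_root (sparse e f) 1.
    split.
      rewrite horner_sparse -[RHS](kill ord0) 1?eq_sym //; apply: eq_bigr => j _.
      by rewrite !mxE /= u0 mulrC.
    rewrite deriv_sparse1 -[RHS](kill i1) 1?eq_sym //; apply: eq_bigr => j _.
    by rewrite !mxE.
  have [g fg] := sparse_proportional e_decr c1 c2 c_only1 c_0 m1 roots.
  have := kill ord_max; rewrite eq_sym => /(_ im).
  rewrite (bigD1 ord_max) //= big1 => [|j jm]; last first.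
    by rewrite !mxE /= eqxx um pow0_e (negbTE jm) mul0r.
  rewrite !mxE /= eqxx um pow0_e eqxx mul1r addr0 fg => /eqP.
  rewrite mulf_eq0 (negbTE c_max) orbF => /eqP g0.
  case/eqP: d0; rewrite (expand_det_row _ i) big1 // => j _.
  by rewrite -/(f j) fg g0 mul0r mulr0.
exists (upd u i x); rewrite /upd !(eq_sym _ i) (negbTE i0) (negbTE ii) (negbTE im).
split=> //; first by move=> l lm; case: eqP => // _; apply: uT.
have -> : \det (rows k.+1 (upd u i x)) = (sparse e f).[x]; last by [].
rewrite (expand_det_row _ i) horner_sparse; apply: eq_bigr => j _.
rewrite !mxE (negbTE i0) (negbTE ii) (negbTE im) /= ltnSn /upd eqxx mulrC; congr (_ * _).
by apply: eq_cofactor => l j' li; apply: rowsE => // m mi; rewrite /upd (negbTE mi).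
Qed.

End Exchange.

Variable C : {mpoly K[n.+3]}.
Hypothesis HC : is_quotient e C.

Lemma special_point : exists v : 'I_n.+2 -> K,
  [/\ v ord0 = 1 /\ v (@Ordinal n.+2 1 isT) = 1, separated (line v C),
      (line v C).[1] != 0, (line v C).[0] != 0 & (e ord0 - n.+2 < size (line v C))%N].
Proof.
have [c [c1 dc1 c2 [c_0 c_max] c_only1]] := exists_good_sparse K0 e_decr e_max e_gcd.
have mc : multiple_root (sparse e c) 1 by [].
have [u [u0 u1 um uT d0]] := rows_step mc c2 c_only1 c_0 c_max (leqnn _).
pose v i := u (widen_ord (leqnSn n.+2) i).
have uv s : vext v s =1 upd u ord_max s.
  move=> i; rewrite /upd; have [[j ->]|->] := widen_or_max i; last by rewrite vext_max eqxx.
  by rewrite vext_widen -val_eqE /= ltn_eqF.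
have {}d0 : \det (confluent i1 e u) != 0.
  move: d0; congr (\det _ != 0); apply/matrixP => i j; rewrite !mxE.
  case: eqP => // _; suff -> : (i == ord0) || (i == ord_max) || (i < n.+2)%N by [].
  have [/eqP ->|] := boolP (i == ord_max); first by rewrite orbT.
  by rewrite -val_eqE /= orbF => im; rewrite ltn_neqAle im -ltnS ltn_ord orbT.
have m1 : ord_max != i1 by [].
pose F := cofactor (confluent i1 e u) ord_max.
pose G := cofactor (confluent i1 (@rho n.+3) u) ord_max.
have eFG : sparse e F = sparse (@rho n.+3) G * line v C.
  apply: poly_eq_horner => s; rewrite hornerM -!det_confluent_upd // horner_line.
  rewrite (meval_eq _ (uv s)); apply: (det_confluent_quotient HC (i0 := ord0)) => //.
have kill l : l != ord_max -> \sum_j confluent i1 e u l j * F j = 0.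
  by move=> lm; rewrite sum_row_cofactor (negbTE lm) mul0r.
have killc l : l != ord_max -> \sum_j confluent i1 e u l j * c j = 0.
  move=> lm; have [->|l1] := eqVneq l i1.
    by rewrite -[RHS]dc1 deriv_sparse1; apply: eq_bigr => j _; rewrite !mxE eqxx.
  rewrite -[RHS](uT l lm) horner_sparse; apply: eq_bigr => j _.
  by rewrite !mxE (negbTE l1) mulrC.
have last_row f : \sum_j confluent i1 e u ord_max j * f j = f ord_max.
  rewrite (bigD1 ord_max) //= big1 => [|j jm]; rewrite !mxE /= um pow0_e //.
    by rewrite eqxx mul1r addr0.
  by rewrite (negbTE jm) mul0r.
have Fm : F ord_max = \det (confluent i1 e u).
  by rewrite -last_row sum_row_cofactor eqxx mul1r.
have Fc j : F j = \det (confluent i1 e u) / c ord_max * c j.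
  pose x := \row_j (F j - \det (confluent i1 e u) / c ord_max * c j).
  have x0 : x = 0.
    apply/eqP; apply: contraNT d0 => x0; rewrite -det_tr; apply/det0P; exists x => //.
    apply/rowP => i; rewrite !mxE.
    transitivity (\sum_j confluent i1 e u i j * F j
      - \det (confluent i1 e u) / c ord_max * \sum_j confluent i1 e u i j * c j).
      rewrite mulr_sumr -sumrB; apply: eq_bigr => k _.
      by rewrite mxE [_^T _ _]mxE; ring.
    have [->|im] := eqVneq i ord_max; last by rewrite kill ?killc // mulr0 subr0.
    by rewrite !last_row Fm divfK // subrr.
  by have := congr1 (fun y : 'rV_n.+3 => y 0 j) x0; rewrite !mxE => /eqP; rewrite subr_eq0 => /eqP.
have {Fc} [g g0 Fc] : exists2 g, g != 0 & forall j, F j = g * c j.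
  by exists (\det (confluent i1 e u) / c ord_max); rewrite // mulf_neq0 ?invr_eq0.
have eF : sparse e F = g *: sparse e c.
  by rewrite /sparse scaler_sumr; apply: eq_bigr => j _; rewrite scalerA Fc.
have sF : size (sparse e F) = (e ord0).+1 by apply: (size_sparse e_decr); rewrite Fc mulf_neq0.
have only1 x : multiple_root (sparse e F) x -> x = 1.
  rewrite eF /multiple_root derivZ !hornerZ => -[/eqP + /eqP].
  by rewrite !mulf_eq0 (negbTE g0) /= => /eqP r1 /eqP r2; apply: c_only1.
have killG l : l != ord_max -> \sum_j confluent i1 (@rho n.+3) u l j * G j = 0.
  by move=> lm; rewrite sum_row_cofactor (negbTE lm) mul0r.
have G1 : (sparse (@rho n.+3) G).[1] = 0.
  rewrite horner_sparse -[RHS](killG ord0) //; apply: eq_bigr => j _.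
  by rewrite [confluent _ _ _ _ _]mxE /= u0 mulrC.
have dG1 : (sparse (@rho n.+3) G)^`().[1] = 0.
  rewrite deriv_sparse1 -[RHS](killG i1) //; apply: eq_bigr => j _.
  by rewrite [confluent _ _ _ _ _]mxE /=.
have E1 : (line v C).[1] != 0.
  have : (sparse e F)^`()^`().[1] != 0 by rewrite eF !derivZ hornerZ mulf_neq0.
  apply: contraNneq => E1; rewrite eFG !(derivM, derivD) !(hornerD, hornerM) G1 dG1 E1.
  by apply/eqP; ring.
exists v; split.
- split; first by rewrite -[RHS]u0; congr u; apply: val_inj.
  by rewrite -[RHS]u1; congr u; apply: val_inj.
- move=> x mx; have x1 : x = 1.
    by apply: only1; rewrite eFG mulrC; apply: multiple_root_mulr.
  by case: mx; rewrite x1 => /eqP; rewrite (negbTE E1).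
- by [].
- have : (sparse e F).[0] != 0.
    rewrite horner_sparse (bigD1 ord_max) //= big1 ?addr0 => [|j jm].
      by rewrite e_max expr0 mulr1 Fm.
    by rewrite pow0_e (negbTE jm) mulr0.
  by apply: contraNneq => E0; rewrite eFG hornerM E0 mulr0.
have F0 : sparse e F != 0 by rewrite -size_poly_eq0 sF.
have G0 : sparse (@rho n.+3) G != 0 by apply: contraNneq F0 => z; rewrite eFG z mul0r.
have L0 : line v C != 0 by apply: contraNneq F0 => z; rewrite eFG z mulr0.
have sG : (size (sparse (@rho n.+3) G) <= n.+3)%N.
  apply: leq_trans (size_sum _ _ _) _; apply/bigmax_leqP => j _.
  by apply: leq_trans (size_scale_leq _ _) _; rewrite size_polyXn ltnS /rho leq_subr.
move: sF; rewrite eFG size_mul // => sF.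
move: L0; rewrite -size_poly_gt0 => L0.
have aux (a b x : nat) : (a + b).-1 = x.+1 -> (a <= n.+3)%N -> (0 < b)%N -> (x - n.+2 < b)%N.
  by lia.
exact: aux sF sG L0.
Qed.

End SpecialPoint.

(** * Specializing polynomials over a domain *)

Section Specialize.
Variables (A B : idomainType) (f : {rmorphism A -> B}).
Implicit Types p q : {poly A}.

Lemma size_map_poly_le p : (size (map_poly f p) <= size p)%N.
Proof.
by apply/leq_sizeP => j le_j; rewrite coef_map /= nth_default ?rmorph0.
Qed.

Lemma size_map_factor p q r : p = q * r -> p != 0 ->
  size (map_poly f p) = size p -> size (map_poly f q) = size q.
Proof.
move=> e p0 sp.
have q0 : q != 0 by apply: contraNneq p0 => z; rewrite e z mul0r.
have r0 : r != 0 by apply: contraNneq p0 => z; rewrite e z mulr0.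
have fp0 : map_poly f p != 0 by rewrite -size_poly_eq0 sp size_poly_eq0.
have fq0 : map_poly f q != 0 by apply: contraNneq fp0 => z; rewrite e rmorphM /= z mul0r.
have fr0 : map_poly f r != 0 by apply: contraNneq fp0 => z; rewrite e rmorphM /= z mulr0.
move: sp; rewrite e rmorphM /= !size_mul //.
have := size_map_poly_le q; have := size_map_poly_le r.
move: fq0 fr0; rewrite -2!size_poly_gt0.
move: (size (map_poly f q)) (size (map_poly f r)) (size q) (size r) => a b a' b'.
by lia.
Qed.

Lemma lead_coef_map_neq0 p : p != 0 ->
  (f (lead_coef p) != 0) = (size (map_poly f p) == size p).
Proof.
move=> p0; apply/idP/eqP => [l0|sp]; first exact: size_map_poly_id0.
rewrite lead_coefE -coef_map -sp -lead_coefE lead_coef_eq0.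
by rewrite -size_poly_eq0 sp size_poly_eq0.
Qed.

Lemma rmorph_resultant p q :
  size (map_poly f p) = size p -> size (map_poly f q) = size q ->
  f (resultant p q) = resultant (map_poly f p) (map_poly f q).
Proof.
move=> sp sq; rewrite /resultant /Sylvester_mx sp sq -det_map_mx map_col_mx.
congr (\det (col_mx _ _)); apply: map_lin1_mx => v;
  by rewrite map_poly_rV rmorphM /= map_rVpoly.
Qed.

Lemma resultant_common_root p q s : (1 < size p)%N -> (1 < size q)%N ->
  (map_poly f p).[s] = 0 -> (map_poly f q).[s] = 0 -> f (resultant p q) = 0.
Proof.
move=> sp sq ps qs; have [[u v] _ /=] := resultant_in_ideal sp sq.
move/(congr1 (fun r => (map_poly f r).[s])).
by rewrite map_polyC hornerC rmorphD !rmorphM /= hornerD !hornerM ps qs !mulr0 addr0.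
Qed.

End Specialize.

Lemma eliminant (A : idomainType) (p q : {poly A}) : is_ufd A ->
  (forall h : {poly A}, irreducible_elt h -> (1 < size h)%N ->
     divides h p -> divides h q -> False) ->
  exists2 c, c != 0 & forall (B : idomainType) (f : {rmorphism A -> B}) s,
    (map_poly f p).[s] = 0 -> (map_poly f q).[s] = 0 -> f c = 0.
Proof.
move=> ufdA noc; have [c [c0 [u [v e]]]] := coprime_elimination ufdA noc.
exists c => // B f s ps qs; have := congr1 (fun r => (map_poly f r).[s]) e.
by rewrite map_polyC hornerC rmorphD !rmorphM /= hornerD !hornerM ps qs !mulr0 addr0.
Qed.

Lemma resultant_separated (K : closedFieldType) (p q : {poly K}) :
  separated (p * q) -> p * q != 0 -> resultant p q != 0.
Proof.
move=> spq pq0; rewrite resultant_eq0 -leqNgt leqNgt; apply/negP => /exists_root[s].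
move/eqP; rewrite -[_ == 0]/(root _ s) root_gcd => /andP[/rootP ps /rootP qs].
apply: (spq s); split; first by rewrite hornerM ps mul0r.
by rewrite derivM hornerD !hornerM ps qs mulr0 mul0r addr0.
Qed.

(* Discriminant argument: separability at one point, in full degree, spreads out. *)
Lemma generic_separated (K : closedFieldType) (n : nat) (p : {poly {mpoly K[n]}}) v0 :
  p != 0 -> size (map_poly (meval v0) p) = size p ->
  separated (map_poly (meval v0) p) ->
  exists2 c : {mpoly K[n]}, c != 0 & forall v, c.@[v] != 0 ->
    size (map_poly (meval v) p) = size p /\ separated (map_poly (meval v) p).
Proof.
move=> p0 sp sep.
have [h irr sh dp ddp|c c0 Hc] := eliminant (p := p) (q := p^`()) (mpoly_is_ufd K n).
  have [a ea] := dp; have [b eb] := ddp.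
  have sfh : (1 < size (map_poly (meval v0) h))%N.
    by rewrite (size_map_factor ea p0 sp).
  have [s hs] := exists_root sfh; apply: (sep s); split.
    by rewrite ea rmorphM hornerM hs mul0r.
  by rewrite deriv_map eb rmorphM hornerM hs mul0r.
exists (c * lead_coef p); first by rewrite mulf_neq0 ?lead_coef_eq0.
move=> v; rewrite mevalM mulf_eq0 negb_or => /andP[cv lv]; split.
  by apply/eqP; rewrite -lead_coef_map_neq0.
move=> s [ps dps]; case/eqP: cv; apply: (Hc _ (meval v) s) => //.
by rewrite -deriv_map.
Qed.

Lemma mpoly_unitP (K : fieldType) (n : nat) (p : {mpoly K[n]}) :
  p \is a GRing.unit -> exists2 c, c != 0 & p = c%:MP.
Proof.
case/andP => /eqP e; rewrite unitfE => p0; by exists p@_0.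
Qed.

Section MsymFacts.
Variables (K : fieldType) (n : nat).
Implicit Types (p q h : {mpoly K[n]}) (s : 'S_n).

Lemma msymKV s : cancel (@msym n K s^-1) (@msym n K s).
Proof. by move=> p; rewrite -msymMm mulVg msym1m. Qed.

Lemma msymVK s : cancel (@msym n K s) (@msym n K s^-1).
Proof. by move=> p; rewrite -msymMm mulgV msym1m. Qed.

Lemma unit_msym s p : (msym s p \is a GRing.unit) = (p \is a GRing.unit).
Proof.
apply/idP/idP => [u|]; last exact: rmorph_unit.
by rewrite -(msymVK s p) rmorph_unit.
Qed.

Lemma irreducible_msym s h : irreducible_elt h -> irreducible_elt (msym s h).
Proof.
move=> [nu irr]; split; first by rewrite unit_msym.
move=> [a [b [na nb e]]]; apply: irr; exists (msym s^-1 a), (msym s^-1 b).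
by rewrite !unit_msym -msymM -e msymVK.
Qed.

Lemma divides_msym s p q : divides p q -> divides (msym s p) (msym s q).
Proof. by case=> c ->; exists (msym s c); rewrite msymM. Qed.

Lemma not_dependsD j p q : ~~ depends j p -> ~~ depends j q -> ~~ depends j (p + q).
Proof.
move=> /hasPn np /hasPn nq; apply/hasPn => m /msuppD_le.
by rewrite mem_cat => /orP[/np|/nq].
Qed.

Lemma not_dependsM j p q : ~~ depends j p -> ~~ depends j q -> ~~ depends j (p * q).
Proof.
move=> np nq; have [->|pq0] := eqVneq (p * q) 0; first by rewrite /depends msupp0.
by rewrite depends_mul // negb_or np.
Qed.

Lemma not_dependsC j c : ~~ depends j (c%:MP : {mpoly K[n]}).
Proof.
by rewrite /depends msuppC; case: eqP => //= _; rewrite mnm0E eqxx.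
Qed.

Lemma depends_scale j c p : c != 0 -> depends j (c *: p) = depends j p.
Proof. by move=> c0; apply: eq_has_r => m; rewrite (perm_mem (msuppZ p c0)). Qed.

Lemma not_depends_mmap (m : nat) j (g : 'I_m -> {mpoly K[n]}) (p : {mpoly K[m]}) :
  (forall i, ~~ depends j (g i)) -> ~~ depends j (mmap (@mpolyC n K) g p).
Proof.
move=> ng; rewrite /mmap; apply: (big_ind (fun q => ~~ depends j q)) => [|a b|x _].
  by rewrite /depends msupp0.
  exact: not_dependsD.
apply: not_dependsM; first exact: not_dependsC.
rewrite /mmap1; apply: (big_ind (fun q => ~~ depends j q)) => [|a b|i _].
  exact: (not_dependsC j 1).
  exact: not_dependsM.
by elim: (x i) => [|k IH]; rewrite ?exprS ?not_dependsM // (not_dependsC j 1).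
Qed.

Lemma not_dependsXU j i : i != j -> ~~ depends j ('X_i : {mpoly K[n]}).
Proof. by move=> ij; rewrite /depends msuppX /= mnm1E (negbTE ij). Qed.

End MsymFacts.

Lemma line_msym (K : closedFieldType) (n : nat) (v : 'I_n -> K) (s : 'S_n.+1) p :
  (forall x, vext v x \o s =1 vext v x) -> line v (msym s p) = line v p.
Proof.
move=> fix_v; apply: poly_eq_horner => x.
apply: (etrans (horner_line v (msym s p) x)); apply: (etrans _ (esym (horner_line v p x))).
by apply: (etrans (meval_msym s p _)); apply: meval_eq.
Qed.

Lemma multiple_root_sqr (R : closedFieldType) (p q : {poly R}) x :
  p.[x] = 0 -> multiple_root (p * (p * q)) x.
Proof.
move=> p0; split; first by rewrite hornerM p0 mul0r.
by rewrite !derivM !(hornerD, hornerM) p0 !(mul0r, mulr0, add0r, addr0).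
Qed.

Lemma irreducible_muni_inv (K : fieldType) (n : nat) (h : {poly {mpoly K[n]}}) :
  irreducible_elt h -> irreducible_elt (muni_inv h).
Proof.
move=> [nu irr]; split.
  by apply: contraNN nu => u; rewrite -(muni_invK h) rmorph_unit.
move=> [a [b [na nb eab]]]; apply: irr; exists (muni a), (muni b).
split; last by rewrite -muniM -eab muni_invK.
  by apply: contraNN na => u; rewrite -(muniK a) rmorph_unit.
by apply: contraNN nb => u; rewrite -(muniK b) rmorph_unit.
Qed.

Lemma divides_muni_inv (K : fieldType) (n : nat) (h : {poly {mpoly K[n]}}) p :
  divides h (muni p) -> divides (muni_inv h) p.
Proof. by case=> g e; exists (muni_inv g); rewrite -(muniK p) e rmorphM. Qed.

Lemma size_map_poly_comp (A A' B : idomainType) (f : {rmorphism A -> A'})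
    (g : {rmorphism A' -> B}) (p : {poly A}) (q : {poly B}) :
  map_poly g (map_poly f p) = q -> size q = size p -> size (map_poly f p) = size p.
Proof.
move=> <- s; apply/eqP; rewrite eqn_leq size_map_poly_le /=.
by rewrite -[leqLHS]s size_map_poly_le.
Qed.

Lemma resultant_specialize_neq0 (A : idomainType) (K : closedFieldType)
    (f : {rmorphism A -> K}) (p q : {poly A}) (p' q' : {poly K}) :
  map_poly f p = p' -> map_poly f q = q' -> size p' = size p -> size q' = size q ->
  separated (p' * q') -> p' * q' != 0 -> f (resultant p q) != 0.
Proof.
move=> ep eq sp sq sep pq0; rewrite rmorph_resultant ?ep ?eq //.
exact: resultant_separated.
Qed.

(** * Factors of the quotient *)

Definition pow_vars (K : comNzRingType) (n d : nat) (p : {mpoly K[n]}) : {mpoly K[n]} :=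
  mmap (@mpolyC n K) (fun i => 'X_i ^+ d) p.

HB.instance Definition _ (K : comNzRingType) n d :=
  GRing.RMorphism.copy (@pow_vars K n d) (mmap (@mpolyC n K) (fun i => 'X_i ^+ d)).

Lemma meval_pow_vars (K : comNzRingType) (n d : nat) (p : {mpoly K[n]}) u :
  (pow_vars d p).@[u] = p.@[fun i => u i ^+ d].
Proof.
rewrite /pow_vars meval_mmap; apply: meval_eq => i.
by rewrite rmorphXn /= mevalXU.
Qed.

Lemma muni_pow_vars (K : idomainType) (n d : nat) (p : {mpoly K[n.+1]}) :
  muni (pow_vars d p) = map_poly (pow_vars d) (muni p) \Po 'X^d.
Proof.
apply: (@mpoly_hom_ext _ _ _ (@muni n K \o @pow_vars K n.+1 d)
  (comp_poly 'X^d \o (map_poly (@pow_vars K n d) \o @muni n K))) => [c|i] /=.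
  by rewrite /pow_vars mmapC muniC map_polyC /= /pow_vars mmapC comp_polyC.
rewrite /pow_vars mmapX mmap1U rmorphXn /=; have [[j ->]|->] := widen_or_max i.
  by rewrite muniX_widen map_polyC /= mmapX mmap1U comp_polyC polyC_exp.
by rewrite muniX_max map_polyX comp_polyX.
Qed.

Lemma scale_inv (F : fieldType) (V : lmodType F) (a : F) (x y : V) :
  a != 0 -> x = a *: y -> y = a^-1 *: x.
Proof. by move=> a0 ->; rewrite scalerA mulVf // scale1r. Qed.

Section PolyBounds.
Variables (R : idomainType).
Implicit Types p q : {poly R}.

Lemma size_alt_last (n m : nat) (e : 'I_n.+1 -> nat) (w : 'I_n -> R)
    (h : 'I_n.+1 -> {poly R}) :
  (forall i, h (widen_ord (leqnSn n) i) = (w i)%:P) -> h ord_max = 'X ->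
  (forall j, (e j <= m)%N) -> (size (alt e h) <= m.+1)%N.
Proof.
move=> hw hm em; rewrite /alt (expand_det_row _ ord_max).
apply: leq_trans (size_sum _ _ _) _; apply/bigmax_leqP => j _.
rewrite (eq_cofactor (B := map_mx polyC (\matrix_(i, j) vext w 0 i ^+ e j))); last first.
  move=> k l km; rewrite !mxE; have [[i ->]|ek] := widen_or_max k.
    by rewrite hw vext_widen -polyC_exp.
  by rewrite ek eqxx in km.
rewrite cofactor_map_mx mulrC mul_polyC mxE hm.
by apply: leq_trans (size_scale_leq _ _) _; rewrite size_polyXn ltnS.
Qed.

Lemma size_mul_quotient p q a b : q != 0 -> (a < b)%N -> (a < size p)%N ->
  (size (p * q)%R <= b.+1)%N -> (size q <= (b - a).+1)%N.
Proof.
move=> q0 ab sp; have p0 : p != 0 by rewrite -size_poly_gt0 (leq_ltn_trans _ sp).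
rewrite size_mul //; have : (0 < size q)%N by rewrite size_poly_gt0.
by move: ab sp; lia.
Qed.

Lemma size_map_comp_pow (f : {rmorphism R -> R}) p d m :
  (size p <= m.+1)%N -> (size (map_poly f p \Po 'X^d) <= (d * m).+1)%N.
Proof.
move=> sp; apply: leq_trans (size_comp_poly_leq _ _) _.
rewrite size_polyXn ltnS mulnC leq_mul2l; apply/orP; right.
by have := leq_trans (size_map_poly_le f p) sp; case: (size _).
Qed.

Lemma size_comp_pow p d : (0 < d)%N -> p != 0 -> size (p \Po 'X^d) = (d * (size p).-1).+1.
Proof.
move=> d_gt0 p0; have := size_comp_poly p 'X^d; rewrite size_polyXn mulnC => <-.
rewrite prednK // size_poly_gt0 -size_poly_eq0.
have [s1|s1] := leqP (size p) 1.
  by rewrite (size1_polyC s1) comp_polyC size_poly_eq0 -(size1_polyC s1).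
rewrite -lt0n; apply: leq_trans (leq_pred _).
by rewrite size_comp_poly size_polyXn muln_gt0 d_gt0 andbT -subn1 subn_gt0.
Qed.

Lemma max_roots_lt p (s : seq R) : p != 0 -> uniq s -> {in s, forall x, p.[x] = 0} ->
  (size s < size p)%N.
Proof.
by move=> p0 us ps; apply: max_poly_roots => //; apply/allP => x /ps/rootP.
Qed.

End PolyBounds.

Section PowQuotient.
Variables (K : closedFieldType) (n d : nat) (e : 'I_n.+3 -> nat) (C1 : {mpoly K[n.+3]}).
Hypothesis HC : is_quotient e C1.

Local Notation r := n.+3.
Local Notation widen := (widen_ord (leqnSn n.+2)).
Local Notation C := (pow_vars d C1).

Lemma pow_quotient_sym s : msym s C = C.
Proof.
rewrite -[X in _ = pow_vars d X](quotient_sym HC s).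
apply: (@mpoly_hom_ext _ _ _ (msym s \o @pow_vars K r d) (@pow_vars K r d \o msym s)) => [c|i] /=.
  by rewrite /pow_vars /msym !mmapC.
by rewrite /pow_vars mmapX mmap1U rmorphXn /= /msym !mmapX !mmap1U mmapX mmap1U.
Qed.

Lemma pow_quotient_plucker (w : 'I_r -> K) :
  let D s t := (s ^+ d - t ^+ d) * C.@[two_points w s t] in
  forall a b c x, D a b * D c x - D a c * D b x + D a x * D b c = 0.
Proof.
move=> D a b c x.
have DE s t : D s t = (s ^+ d - t ^+ d) * C1.@[two_points (fun i => w i ^+ d) (s ^+ d) (t ^+ d)].
  congr (_ * _); rewrite meval_pow_vars; apply: meval_eq => i.
  by rewrite /two_points; do 2?case: eqP => // _.
rewrite !DE; exact: (quotient_plucker (fun i => w i ^+ d) _ HC).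
Qed.

Lemma quotient_scale t u : C1.@[fun i => t * u i] * t ^+ (\sum_(j < r) rho j) =
  t ^+ (\sum_j e j) * C1.@[u].
Proof.
pose X i : {mpoly K[r]} := 'X_i.
have E : alt (@rho r) X * (t%:MP ^+ (\sum_(j < r) rho j) * mmap (@mpolyC r K) (fun i => t%:MP * X i) C1)
    = alt (@rho r) X * (t%:MP ^+ (\sum_j e j) * C1).
  rewrite [RHS]mulrCA -HC -alt_scale (quotient_hom HC (@mpolyC r K)) alt_scale.
  by rewrite mulrCA mulrA.
have {E} := mulfI (alt_rho_neq0 (@mpolyX_inj K r)) E.
move/(congr1 (meval u)); rewrite !mevalM !rmorphXn /= mevalC meval_mmap => <-.
by rewrite mulrC; congr (_ * _); apply: meval_eq => i; rewrite mevalM mevalC mevalXU.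
Qed.

Lemma pow_quotient_scale t u : t != 0 -> C.@[fun i => t * u i] = 0 -> C.@[u] = 0.
Proof.
move=> t0; rewrite !meval_pow_vars.
rewrite (meval_eq (v2 := fun i => t ^+ d * u i ^+ d)) => [C0|i]; last by rewrite exprMn.
have := quotient_scale (t ^+ d) (fun i => u i ^+ d).
rewrite C0 mul0r => /esym/eqP; rewrite mulf_eq0 expf_eq0 expf_eq0 (negbTE t0) !andbF /=.
by move/eqP.
Qed.

Lemma line_pow_vars v (p : {mpoly K[r]}) :
  line v (pow_vars d p) = line (fun i => v i ^+ d) p \Po 'X^d.
Proof.
apply: poly_eq_horner => s; rewrite (horner_line v (pow_vars d p) s).
rewrite horner_comp hornerXn (horner_line _ p) meval_pow_vars.
by apply: meval_eq => i; have [[j ->]|->] := widen_or_max i; rewrite ?vext_widen ?vext_max.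
Qed.

Lemma horner_line_pow v s t : s ^+ d = t ^+ d -> (line v C).[s] = (line v C).[t].
Proof. by move=> st; rewrite line_pow_vars !horner_comp !hornerXn st. Qed.

Lemma size_muni_alt_rho : (n.+2 < size (muni (alt (@rho r) (fun i => 'X_i : {mpoly K[r]}))))%N.
Proof.
pose s := [seq 'X_i : {mpoly K[n.+2]} | i <- enum 'I_n.+2].
have ss : size s = n.+2 by rewrite size_map size_enum_ord.
rewrite -[X in (X < _)%N]ss; apply: max_roots_lt.
- by rewrite muni_eq0 (alt_rho_neq0 (@mpolyX_inj _ _)).
- by rewrite map_inj_uniq ?enum_uniq //; exact: mpolyX_inj.
move=> x /mapP[i _ ->].
rewrite rmorph_alt -[_.[_]]/(horner_eval _ _) rmorph_alt.
apply: (@alt_repeat _ _ _ _ (widen i) ord_max); first by rewrite -val_eqE /= ltn_eqF.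
by rewrite /= muniX_widen muniX_max /horner_eval hornerC hornerX.
Qed.

Hypothesis K0 : [pchar K] =i pred0.
Hypothesis d_gt0 : (0 < d)%N.
Hypothesis e_decr : forall i j : 'I_n.+3, (i < j)%N -> (e j < e i)%N.
Hypothesis e_max : e ord_max = 0%N.
Hypothesis e_gcd : \big[gcdn/0%N]_i e i = 1%N.
Hypothesis e_big : (n.+2 < e ord0)%N.

Let N := (e ord0 - n.+2)%N.

Lemma size_muni_alt : (size (muni (alt e (fun i => 'X_i : {mpoly K[r]}))) <= (e ord0).+1)%N.
Proof.
rewrite rmorph_alt; apply: (size_alt_last (w := fun i => 'X_i)) => [i||j] /=.
- exact: muniX_widen.
- exact: muniX_max.
have [->//|j0] := eqVneq j ord0; apply/ltnW/e_decr.
by rewrite lt0n -val_eqE in j0 *.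
Qed.

Lemma quotient_neq0 : C1 != 0.
Proof.
have [v [_ _ _ E0 _]] := special_point K0 e_decr e_max e_gcd HC.
by apply: contraNneq E0 => ->; rewrite rmorph0 horner0.
Qed.

Lemma size_muni_quotient : (size (muni C1) <= N.+1)%N.
Proof.
have := size_muni_alt; have := size_muni_alt_rho; rewrite HC muniM => sp.
apply: (size_mul_quotient _ e_big sp).
by rewrite muni_eq0 quotient_neq0.
Qed.

Lemma nth_root_exists (x : K) : exists y, y ^+ d = x /\ (x = 1 -> y = 1).
Proof.
have [->|x1] := eqVneq x 1; first by exists 1; rewrite expr1n.
have [|y] := @exists_root _ ('X^d - x%:P); first by rewrite size_XnsubC.
rewrite hornerD hornerN hornerXn hornerC => /eqP; rewrite subr_eq0 => /eqP yx.
by exists y; split=> // /eqP; rewrite (negbTE x1).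
Qed.

Lemma special_line : exists v : 'I_n.+2 -> K,
  [/\ v ord0 = 1 /\ v (@Ordinal n.+2 1 isT) = 1, separated (line v C),
      (line v C).[1] != 0, (line v C).[0] != 0 &
      size (line v C) = (d * N).+1 /\ size (muni C) = (d * N).+1].
Proof.
have [v' [[v0 v1] sep E1 E0 sz]] := special_point K0 e_decr e_max e_gcd HC.
have [v vE] := fin_all_exists (fun i => nth_root_exists (v' i)).
have lineE : line v C = line v' C1 \Po 'X^d.
  rewrite line_pow_vars; congr (_ \Po _); apply: poly_eq_horner => s.
  rewrite !horner_line; apply: meval_eq => i; have [[j ->]|->] := widen_or_max i.
    by rewrite !vext_widen; have [] := vE j.
  by rewrite !vext_max.
have L0 : line v' C1 != 0 by apply: contraNneq E0 => ->; rewrite horner0.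
have sL : size (line v' C1) = N.+1.
  apply/eqP; rewrite eqn_leq sz andbT; apply: leq_trans size_muni_quotient.
  exact: size_map_poly_le.
have sC : size (line v C) = (d * N).+1 by rewrite lineE size_comp_pow // sL.
exists v; split.
- by split; [have [_] := vE ord0|have [_] := vE (@Ordinal n.+2 1 isT)]; apply.
- move=> x [] ; rewrite lineE horner_comp hornerXn deriv_comp hornerM horner_comp !hornerXn.
  rewrite derivXn hornerMn hornerXn => p0 /eqP; rewrite mulf_eq0 -mulr_natr mulf_eq0.
  rewrite (negbTE (natK_neq0 K0 d_gt0)) orbF => /orP[/eqP dp0|]; first exact: (sep (x ^+ d)).
  rewrite expf_eq0 => /andP[_ /eqP x0].
  by move: p0; rewrite x0 expr0n eqn0Ngt d_gt0 => /eqP; rewrite (negbTE E0).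
- by rewrite lineE horner_comp hornerXn expr1n.
- by rewrite lineE horner_comp hornerXn expr0n eqn0Ngt d_gt0.
split; first exact: sC.
apply/eqP; rewrite eqn_leq -{2}sC; apply/andP; split; last exact: size_map_poly_le.
by rewrite muni_pow_vars; apply: size_map_comp_pow; apply: size_muni_quotient.
Qed.

End PowQuotient.

Record split_quotient (K : closedFieldType) (n d N : nat) (C : {mpoly K[n.+3]}) : Prop :=
  SplitQuotient {
  split_sym : forall s, msym s C = C;
  split_plucker : forall w : 'I_n.+3 -> K,
    let D s t := (s ^+ d - t ^+ d) * C.@[two_points w s t] in
    forall a b c x, D a b * D c x - D a c * D b x + D a x * D b c = 0;
  split_scale : forall t u, t != 0 -> C.@[fun i => t * u i] = 0 -> C.@[u] = 0;
  split_pow : forall v s t, s ^+ d = t ^+ d -> (line v C).[s] = (line v C).[t];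
  split_special : exists v : 'I_n.+2 -> K,
    [/\ v ord0 = 1 /\ v (@Ordinal n.+2 1 isT) = 1, separated (line v C),
        (line v C).[1] != 0, (line v C).[0] != 0 &
        size (line v C) = (d * N).+1 /\ size (muni C) = (d * N).+1] }.

Section Factors.
Variables (K : closedFieldType) (n d N : nat) (C : {mpoly K[n.+3]}).
Hypothesis QC : split_quotient d N C.

Local Notation r := n.+3.
Let i1 : 'I_r := @Ordinal r 1 isT.

Lemma C_perm (s : 'S_r) u : C.@[u \o s] = C.@[u].
Proof. by rewrite -meval_msym (split_sym QC). Qed.

Lemma C_neq0 : C != 0.
Proof.
have [v [_ _ E1 _ _]] := split_special QC.
by apply: contraNneq E1 => ->; rewrite rmorph0 horner0.
Qed.

Lemma muniC_neq0 : muni C != 0.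
Proof. by rewrite muni_eq0 C_neq0. Qed.

Lemma size_line_factor v (p q : {mpoly K[r]}) : C = p * q ->
  size (line v C) = size (muni C) -> size (line v p) = size (muni p).
Proof.
by move=> e0 sz; apply: (size_map_factor (r := muni q) _ muniC_neq0 sz); rewrite e0 muniM.
Qed.

(* A symmetry fixing a line on which [C] has simple roots preserves every factor:
   otherwise the square of the restricted factor would divide the restriction of [C]. *)
Lemma factor_msym_line h s v : irreducible_elt h -> divides h C ->
  separated (line v C) -> (1 < size (line v h))%N -> line v (msym s h) = line v h ->
  exists2 c, c != 0 & msym s h = c *: h.
Proof.
move=> irr [g eC] sep sh fix_h.
have irrs := irreducible_msym s irr.
have ds : divides (msym s h) (h * g).
  by rewrite -eC -(split_sym QC s) eC; exists (msym s g); rewrite msymM.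
have [d1|[g' eg]] := ufd_prime (mpoly_is_ufd K r) irrs ds.
  have [u uu eh] := irreducible_associate irr (proj1 irrs) d1.
  have [c c0 eu] := mpoly_unitP uu.
  have eh' : h = c *: msym s h by rewrite -mul_mpolyC -eu -eh.
  exists c^-1; first by rewrite invr_eq0.
  exact: (scale_inv c0 eh').
have [x hx] := exists_root sh; case: (sep x).
have -> : line v C = line v h * (line v h * line v g').
  by rewrite eC eg !lineM fix_h.
exact: multiple_root_sqr.
Qed.

Lemma depends_nonunit (h : {mpoly K[r]}) : h != 0 -> h \isn't a GRing.unit ->
  exists j, depends j h.
Proof.
move=> h0 nu; apply: NNPP => no.
have e0 : h = (h@_0)%:MP.
  by apply: not_depends_const => j; apply/negP => dj; apply: no; exists j.
case/negP: nu; apply/andP; split; first by rewrite -e0.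
by rewrite unitfE; apply: contraNneq h0 => c0; rewrite e0 c0.
Qed.

Lemma factor_tperm01 h : irreducible_elt h -> divides h C -> depends ord_max h ->
  exists2 c, c != 0 & msym (tperm ord0 i1) h = c *: h.
Proof.
move=> irr dh dm; have [v [[v0 v1] sep _ _ [sC sm]]] := split_special QC.
have [g eC] := dh; apply: (factor_msym_line irr dh sep).
  by rewrite (size_line_factor eC (etrans sC (esym sm))) depends_max.
apply: line_msym => s i /=.
have e0 : vext v s ord0 = 1.
  by rewrite -[RHS]v0 -(vext_widen v s); congr (vext v s _); apply: val_inj.
have e1 : vext v s i1 = 1.
  by rewrite -[RHS]v1 -(vext_widen v s); congr (vext v s _); apply: val_inj.
by case: tpermP => [->|->|//]; rewrite e0 e1.
Qed.

Lemma perm_three (i k j : 'I_r) : i != k -> i != j -> k != j ->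
  exists s : 'S_r, [/\ s ord0 = i, s i1 = k & s ord_max = j].
Proof.
move=> ik ij kj; pose s1 := tperm ord_max j.
have n0m : (ord0 == ord_max :> 'I_r) = false by [].
have n1m : (i1 == ord_max :> 'I_r) = false by [].
have n10 : (i1 == ord0 :> 'I_r) = false by [].
pose i' := s1 i; pose k' := s1 k.
have s1m x : (s1 x == ord_max) = (x == j).
  by rewrite -[ord_max](tpermR ord_max j) (inj_eq perm_inj).
have i'm : i' != ord_max by rewrite s1m.
have k'm : k' != ord_max by rewrite s1m.
have ik' : i' != k' by rewrite (inj_eq perm_inj).
pose t1 := tperm ord0 i'; pose k2 := t1 k'.
have t1m : t1 ord_max = ord_max by rewrite tpermD // ?n0m.
have k20 : k2 != ord0.
  by rewrite -[ord0](tpermR ord0 i') (inj_eq perm_inj) eq_sym.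
have k2m : k2 != ord_max by rewrite -t1m (inj_eq perm_inj).
pose t2 := tperm i1 k2.
exists (t2 * t1 * s1)%g; rewrite !permM; split.
- have -> : t2 ord0 = ord0 by rewrite tpermD ?n10.
  by rewrite /t1 tpermL /i' tpermK.
- have -> : t2 i1 = k2 by rewrite /t2 tpermL.
  by rewrite /k2 tpermK /k' tpermK.
- have -> : t2 ord_max = ord_max by rewrite tpermD ?n1m.
  by rewrite t1m /s1 tpermL.
Qed.

Lemma divides_msym_quotient s h : divides h C -> divides (msym s h) C.
Proof. by move/(divides_msym s); rewrite (split_sym QC). Qed.

Lemma factor_tperm h i k j : irreducible_elt h -> divides h C -> depends j h ->
  i != k -> i != j -> k != j -> exists2 c, c != 0 & msym (tperm i k) h = c *: h.
Proof.
move=> irr dh dj ik ij kj; have [s [s0 s1 sm]] := perm_three ik ij kj.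
have [|||c c0 ec] := @factor_tperm01 (msym s^-1 h).
- exact: irreducible_msym.
- exact: divides_msym_quotient.
- by rewrite -(permK s ord_max) sm depends_msym.
exists c => //.
have -> : tperm i k = (s^-1 * (tperm ord0 i1 * s))%g by rewrite -s0 -s1 -tpermJ conjgE.
by rewrite msymMm msymMm ec msymZ msymKV.
Qed.

Lemma factor_depends_other h j : irreducible_elt h -> divides h C -> depends j h ->
  exists2 i, i != j & depends i h.
Proof.
move=> irr dh dj; apply: NNPP => no.
have nd i : i != j -> ~~ depends i h by move=> ij; apply/negP => di; apply: no; exists i.
pose h' := msym (tperm j ord_max) h.
have dm : depends ord_max h' by rewrite -[ord_max](tpermL j) depends_msym.
have ndm i : i != ord_max -> ~~ depends i h'.
  move=> im; rewrite -(tpermK j ord_max i) depends_msym; apply: nd.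
  by rewrite -[X in _ != X](tpermR j ord_max) (inj_eq perm_inj).
have [g eC] : divides h' C by apply: divides_msym_quotient.
have [v [_ _ E1 E0 [sC sm]]] := split_special QC.
have [c hc] : exists c, (line v h').[c] = 0.
  by apply: exists_root; rewrite (size_line_factor eC (etrans sC (esym sm))) depends_max.
have vanish w : C.@[vext w c] = 0.
  have hw : h'.@[vext w c] = 0.
    rewrite -[RHS]hc horner_line; apply: eq_meval_depends => i di.
    have [[k ek]|->] := widen_or_max i; last by rewrite !vext_max.
    have im : i != ord_max by rewrite ek -val_eqE /= ltn_eqF.
    by move: (ndm i im); rewrite di.
  by rewrite eC mevalM hw mul0r.
have [c0|c0] := eqVneq c 0.
  by move: (vanish v); rewrite c0 -horner_line => z; rewrite z eqxx in E0.
case/eqP: E1; rewrite horner_line; apply: (split_scale QC c0).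
rewrite -[RHS](vanish (fun i => c * v i)); apply: meval_eq => i.
have [[k ->]|->] := widen_or_max i; first by rewrite !vext_widen.
by rewrite !vext_max mulr1.
Qed.

Lemma factor_depends h j : irreducible_elt h -> divides h C -> depends j h.
Proof.
move=> irr dh.
have [j0 dj0] := depends_nonunit (irreducible_neq0 irr) (proj1 irr).
apply: contraT => ndj; have jj0 : j != j0 by apply: contraNneq ndj => ->.
have [i ij0 di] := factor_depends_other irr dh dj0.
have ij : i != j by apply: contraNneq ndj => <-.
have [c c0 ec] := factor_tperm irr dh dj0 ij ij0 jj0.
by case/negP: ndj; rewrite -(tpermL i j) -(depends_scale _ _ c0) -ec depends_msym.
Qed.

Lemma third_index (i k : 'I_r) : exists j, i != j /\ k != j.
Proof.
apply: NNPP => no.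
have H j : (i == j) || (k == j).
  by apply: contraT; rewrite negb_or => /andP[a b]; case: no; exists j.
case/orP: (H ord0) => /eqP/(congr1 val)/= e1; case/orP: (H i1) => /eqP/(congr1 val)/= e2;
  by case/orP: (H ord_max) => /eqP/(congr1 val)/=; move=> e3; move: e1 e2 e3; clear; lia.
Qed.

Lemma factor_zero_tperm h i k u : irreducible_elt h -> divides h C ->
  h.@[u] = 0 -> h.@[u \o tperm i k] = 0.
Proof.
move=> irr dh hu; have [<-|ik] := eqVneq i k.
  by rewrite -[RHS]hu; apply: meval_eq => x /=; rewrite tperm1 perm1.
have [j [ij kj]] := third_index i k.
have [c c0 ec] := factor_tperm irr dh (factor_depends j irr dh) ik ij kj.
by rewrite -meval_msym ec mevalZ hu mulr0.
Qed.

End Factors.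

(** * A generic confluence point *)

Lemma map_meval_mmap (K : idomainType) (n m : nat) (g : 'I_n -> {mpoly K[m]})
    (P : {poly {mpoly K[n]}}) v :
  map_poly (meval v) (map_poly (mmap (@mpolyC m K) g) P) =
  map_poly (meval (fun i => (g i).@[v])) P.
Proof. by apply/polyP => i; rewrite !coef_map /= meval_mmap. Qed.

Definition substX (K : idomainType) (n : nat) (i0 : 'I_n) (q : {mpoly K[n]}) :
    {poly {mpoly K[n]}} :=
  mmap (polyC \o @mpolyC n K) (fun i => if i == i0 then 'X else ('X_i)%:P) q.

Lemma meval_substX (K : idomainType) (n : nat) (i0 : 'I_n) (q : {mpoly K[n]}) v s :
  (map_poly (meval v) (substX i0 q)).[s] = q.@[upd v i0 s].
Proof.
apply: (@mpoly_hom_ext _ _ _ (horner_eval s \o (map_poly (meval v) \o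
  mmap (polyC \o @mpolyC n K) (fun i => if i == i0 then 'X else ('X_i)%:P)))
  (meval (upd v i0 s))) => [c|i] /=.
  by rewrite mmapC /= map_polyC /= /horner_eval hornerC !mevalC.
rewrite mmapX mmap1U mevalXU /upd /horner_eval; case: eqP => _.
  by rewrite map_polyX hornerX.
by rewrite map_polyC hornerC /= mevalXU.
Qed.

Section GenericPoint.
Variables (K : closedFieldType) (n d N : nat) (C : {mpoly K[n.+3]}).
Hypothesis QC : split_quotient d N C.
Hypothesis K0 : [pchar K] =i pred0.
Hypothesis d_gt0 : (0 < d)%N.

Local Notation r := n.+3.
Local Notation widen := (widen_ord (leqnSn n.+2)).
Let j1 : 'I_n.+2 := @Ordinal n.+2 1 isT.
Implicit Types v : 'I_n.+2 -> K.

Lemma two_points_vext v z a b : two_points (vext v z) a b =1 vext (upd v ord0 a) b.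
Proof.
move=> i; rewrite /two_points; have [[j ->]|->] := widen_or_max i.
  rewrite !vext_widen /upd -!val_eqE /=; case: eqP => // _.
  by rewrite ltn_eqF.
have -> : (ord_max == ord0 :> 'I_r) = false by [].
by rewrite !vext_max eqxx.
Qed.

Lemma vext_upd_swap v a b :
  vext (upd v ord0 a) b \o tperm ord0 ord_max =1 vext (upd v ord0 b) a.
Proof.
have e0 x y : vext (upd v ord0 x) y ord0 = x.
  have -> : ord0 = widen ord0 by apply: val_inj.
  by rewrite vext_widen /upd eqxx.
move=> i /=; case: tpermP => [->|->|i0 im]; rewrite ?e0 ?vext_max //.
have [[j ej]|//] := widen_or_max i; rewrite ej !vext_widen /upd.
by case: eqP => // j0; case: i0; rewrite ej j0; apply: val_inj.
Qed.

Lemma horner_line_swap v a b :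
  (line (upd v ord0 a) C).[b] = (line (upd v ord0 b) C).[a].
Proof.
apply: (etrans (horner_line _ _ _)); apply: (etrans _ (esym (horner_line _ _ _))).
by rewrite -(C_perm QC (tperm ord0 ord_max)); apply: meval_eq; apply: vext_upd_swap.
Qed.

Definition pencil v a : {poly K} := ((a ^+ d)%:P - 'X^d) * line (upd v ord0 a) C.

Lemma horner_pencil v a b :
  (pencil v a).[b] = (a ^+ d - b ^+ d) * (line (upd v ord0 a) C).[b].
Proof. by rewrite hornerM hornerD hornerN hornerC hornerXn. Qed.

Lemma pencil_plucker v a b c x :
  (pencil v a).[b] * (pencil v c).[x] - (pencil v a).[c] * (pencil v b).[x]
  + (pencil v a).[x] * (pencil v b).[c] = 0.
Proof.
have E s t : (pencil v s).[t] = (s ^+ d - t ^+ d) * C.@[two_points (vext v 0) s t].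
  rewrite horner_pencil; congr (_ * _); apply: (etrans (horner_line _ _ _)).
  by apply: meval_eq => i; rewrite two_points_vext.
by rewrite !E; apply: (split_plucker QC (vext v 0)).
Qed.

Lemma pencil_proportional v a s : (pencil v a).[s] = 0 ->
  forall c, (pencil v a).[c] *: pencil v s = (pencil v s).[c] *: pencil v a.
Proof.
move=> as0 c; apply: poly_eq_horner => x; rewrite !hornerZ.
have := pencil_plucker v a s c x; rewrite as0 mul0r add0r addrC => /eqP.
by rewrite subr_eq0 => /eqP <-; rewrite mulrC.
Qed.

Lemma size_pencil v a : line (upd v ord0 a) C != 0 ->
  size (pencil v a) = (d + size (line (upd v ord0 a) C))%N.
Proof.
move=> L0; rewrite /pencil -opprB mulNr size_polyN size_mul //.
  by rewrite size_XnsubC.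
by rewrite -size_poly_eq0 size_XnsubC.
Qed.

Lemma line_degenerate v a s : size (line (upd v ord0 a) C) = size (muni C) ->
  (pencil v a).[s] = 0 -> (lead_coef (muni C)).@[upd v ord0 s] = 0 ->
  line (upd v ord0 s) C = 0.
Proof.
move=> sa as0 ls; apply/eqP; apply: contraT => L0.
have sL : (size (line (upd v ord0 s) C) < size (muni C))%N.
  rewrite ltn_neqAle size_map_poly_le andbT; apply/negP.
  rewrite -(lead_coef_map_neq0 (meval _)) /=; first by rewrite ls eqxx.
  by apply: contraNneq L0 => z; rewrite /line /= z map_poly0.
have a0 : line (upd v ord0 a) C != 0.
  by rewrite -size_poly_gt0 sa; apply: leq_ltn_trans sL.
have ps0 : pencil v s != 0.
  by rewrite -size_poly_gt0 size_pencil // addn_gt0 d_gt0.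
have [c pc] := exists_nonroot ps0.
have := congr1 (fun p : {poly K} => size p) (pencil_proportional as0 c).
have := size_scale_leq (pencil v a).[c] (pencil v s).
rewrite [size (_ *: pencil v a)]size_scale // !size_pencil // sa => le1 e1.
by move: le1; rewrite e1 leq_add2l leqNgt sL.
Qed.

(* [pE] is [C] where the variables 0 and 1 agree, as a polynomial in the last variable;
   [pT] is the leading coefficient of [C] with variable 0 replaced by the last one. *)
Let merge : 'I_n.+2 -> {mpoly K[n.+2]} := fun i => if i == ord0 then 'X_j1 else 'X_i.
Let pE := map_poly (mmap (@mpolyC n.+2 K) merge) (muni C).
Let pT := substX ord0 (lead_coef (muni C)).
Let merged v := upd v ord0 (v j1).

Let map_pE v : map_poly (meval v) pE = line (merged v) C.
Proof.
rewrite /pE map_meval_mmap; apply/polyP => i; rewrite !coef_map /=.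
by apply: meval_eq => k; rewrite /merge /merged /upd; case: eqP; rewrite mevalXU.
Qed.

Let pE_spec : exists v, [/\ merged v =1 v, v j1 = 1 & [/\ separated (line v C),
   (line v C).[1] != 0, size (line v C) = size (muni C) & size pE = size (muni C)]].
Proof.
have [v [[v0 v1] sep E1 _ [sC sm]]] := split_special QC.
have mv : merged v =1 v by move=> i; rewrite /merged /upd; case: eqP => // ->; rewrite v0 v1.
have e1 : map_poly (meval v) pE = line v C.
  by rewrite map_pE; apply/polyP => i; rewrite !coef_map; apply: meval_eq.
exists v; split=> //; split=> //; first by rewrite sC sm.
apply/eqP; rewrite eqn_leq size_map_poly_le /= sm -sC -e1.
exact: size_map_poly_le.
Qed.

Let pE0 : pE != 0.
Proof.
have [v [_ _ [_ _ _ sp]]] := pE_spec.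
by rewrite -size_poly_gt0 sp size_poly_gt0 (muniC_neq0 QC).
Qed.

Let generic_merge : exists2 c : {mpoly K[n.+2]}, c != 0 & forall v, c.@[v] != 0 ->
  [/\ size (line (merged v) C) = size (muni C), separated (line (merged v) C),
      (line (merged v) C).[v j1] != 0 & v j1 != 0].
Proof.
have [v0 [mv v1 [sep E1 sC sp]]] := pE_spec.
have e1 : map_poly (meval v0) pE = line v0 C.
  by rewrite map_pE; apply/polyP => i; rewrite !coef_map; apply: meval_eq.
have [||c c0 Hc] := generic_separated (v0 := v0) pE0; rewrite ?e1 //; first by rewrite sC sp.
have hE v : (pE.['X_j1]).@[v] = (line (merged v) C).[v j1].
  by rewrite -map_pE -horner_map /= mevalXU.
exists (c * pE.['X_j1] * 'X_j1).
  rewrite !mulf_neq0 //; last by apply/eqP => /(congr1 (meval v0))/eqP; rewrite mevalXU v1 meval0 oner_eq0.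
  apply/eqP => /(congr1 (meval v0)); rewrite hE meval0 -map_pE e1 v1 => /eqP.
  by rewrite (negbTE E1).
move=> v; rewrite !mevalM !mulf_eq0 !negb_or mevalXU hE => /andP[/andP[cv ev] v10].
by have [] := Hc v cv; rewrite map_pE sp.
Qed.

Let no_common_factor (h : {poly {mpoly K[n.+2]}}) :
  irreducible_elt h -> (1 < size h)%N -> divides h pE -> divides h pT -> False.
Proof.
move=> irr sh dE dT; have ufdA := mpoly_is_ufd K n.+2.
case: (classic (divides h (muni C))) => [[g eC]|nd].
  have irr0 := irreducible_muni_inv irr.
  have d0 : divides (muni_inv h) C by apply: divides_muni_inv; exists g.
  have := factor_depends QC (widen ord0) irr0 d0.
  have [g' eE] := dE.
  have e3 : muni_inv h * muni_inv g' = muni_inv pE by rewrite eE rmorphM.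
  have E0 : muni_inv h * muni_inv g' != 0.
    rewrite e3; apply: contraNneq pE0 => z.
    by rewrite -(muni_invK pE) z muni0.
  have : ~~ depends (widen ord0) (muni_inv h * muni_inv g').
    rewrite e3.
    have -> : muni_inv pE = mmap (@mpolyC n.+3 K)
       (vext (fun i => mwiden (merge i)) 'X_ord_max) C.
      apply: (@mpoly_hom_ext _ _ _ (@muni_inv _ K \o (map_poly (mmap (@mpolyC n.+2 K) merge) \o @muni _ K))
        (mmap (@mpolyC n.+3 K) (vext (fun i => mwiden (merge i)) 'X_ord_max))) => [c|i] /=.
        by rewrite muniC map_polyC muni_invC /= !mmapC mwidenC.
      rewrite mmapX mmap1U; have [[k ->]|->] := widen_or_max i.
        by rewrite muniX_widen map_polyC muni_invC /= mmapX mmap1U vext_widen.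
      by rewrite muniX_max map_polyX muni_invX vext_max.
    apply: not_depends_mmap => i; have [[k ->]|->] := widen_or_max i.
      rewrite vext_widen /merge; case: eqP => [_|/eqP k0]; rewrite mwidenXU.
        by apply: not_dependsXU.
      by apply: not_dependsXU; rewrite -val_eqE.
    by rewrite vext_max; apply: not_dependsXU.
  by rewrite depends_mul // negb_or => /andP[/negbTE ->].
have [k irrk sk dkh dkC|c c0 Hc] := eliminant (p := h) (q := muni C) ufdA.
  have [u uu eh] := irreducible_associate irr (proj1 irrk) dkh.
  apply: nd; apply: divides_trans dkC; exists u^-1.
  by rewrite eh mulrAC mulrV // mul1r.
have h0 := irreducible_neq0 irr.
have nz : c * lead_coef h * lead_coef pE != 0 by rewrite !mulf_neq0 ?lead_coef_eq0.
have [v] := exists_nonzero nz.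
rewrite !mevalM !mulf_eq0 !negb_or => /andP[/andP[cv hv] ev].
have sE : size (line (merged v) C) = size (muni C).
  have [v0 [_ _ [_ _ _ <-]]] := pE_spec.
  by rewrite -map_pE; apply/eqP; rewrite -(lead_coef_map_neq0 (meval v)).
have [s hs] : exists s, (map_poly (meval v) h).[s] = 0.
  by apply: exists_root; rewrite size_map_poly_id0.
have [aE eE] := dE; have [aT eT] := dT.
have Es : (line (merged v) C).[s] = 0 by rewrite -map_pE eE rmorphM hornerM hs mul0r.
have Ts : (lead_coef (muni C)).@[upd v ord0 s] = 0.
  by rewrite -meval_substX -/pT eT rmorphM hornerM hs mul0r.
have L0 : line (upd v ord0 s) C = 0.
  by apply: (line_degenerate sE) => //; rewrite horner_pencil Es mulr0.
have Cs : (line v C).[s] = 0.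
  have := horner_line_swap v (v ord0) s; rewrite L0 horner0 => <-.
  congr (_.[s]); apply/polyP => i; rewrite !coef_map /=; apply: meval_eq => k.
  by rewrite /upd; case: eqP => // ->.
by case/eqP: cv; apply: (Hc _ (meval v) s).
Qed.

Lemma factor_point h : irreducible_elt h -> divides h C -> exists v,
  [/\ h.@[vext v (v ord0)] = 0, separated (line v C) & size (line v C) = size (muni C)].
Proof.
move=> irr dh; have muniC0 := muniC_neq0 QC.
have [B B0 HB] := generic_merge.
have [c c0 Hc] := eliminant (mpoly_is_ufd K n.+2) no_common_factor.
have [v] := exists_nonzero (mulf_neq0 B0 c0).
rewrite mevalM mulf_eq0 negb_or => /andP[Bv cv].
have [sE sep Ex x0] := HB v Bv; set x := v j1 in sE sep Ex x0.
have [g eC] := dh.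
have [z hz] : exists z, (line (merged v) h).[z] = 0.
  apply: exists_root; rewrite (size_line_factor QC eC sE) depends_max.
  exact: (factor_depends QC _ irr dh).
have Ez : (line (merged v) C).[z] = 0 by rewrite eC; apply: line_mul_root.
have lz : (lead_coef (muni C)).@[upd v ord0 z] != 0.
  apply: contraNneq cv => lz; apply/eqP; apply: (Hc _ (meval v) z).
    by rewrite map_pE.
  by rewrite meval_substX.
have sz : size (line (upd v ord0 z) C) = size (muni C).
  by apply/eqP; rewrite -(lead_coef_map_neq0 (meval _)).
have Lz0 : line (upd v ord0 z) C != 0 by rewrite -size_poly_gt0 sz size_poly_gt0.
have Lx0 : line (upd v ord0 x) C != 0 by rewrite -size_poly_gt0 sE size_poly_gt0.
have px0 : pencil v x != 0 by rewrite -size_poly_gt0 size_pencil // addn_gt0 d_gt0.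
have pz0 : pencil v z != 0 by rewrite -size_poly_gt0 size_pencil // addn_gt0 d_gt0.
have xz : (pencil v x).[z] = 0 by rewrite horner_pencil Ez mulr0.
have sep_px : separated (pencil v x).
  move=> y [p0 dp0]; have := p0; rewrite horner_pencil => /eqP; rewrite mulf_eq0.
  move: dp0; rewrite derivM derivB derivC derivXn sub0r hornerD !hornerM.
  rewrite hornerN hornerMn hornerXn hornerD hornerN hornerC hornerXn.
  move=> dp0 /orP[/eqP xy|/eqP Ey].
    have Ey : (line (merged v) C).[y] != 0.
      have exy : x ^+ d = y ^+ d by apply/eqP; rewrite -subr_eq0 xy.
      by rewrite -(@split_pow _ _ _ _ _ QC (merged v) x y exy).
    move/eqP: dp0; rewrite xy mul0r addr0 mulf_eq0 (negbTE Ey) orbF oppr_eq0 -mulr_natr mulf_eq0.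
    rewrite (negbTE (natK_neq0 K0 d_gt0)) orbF expf_eq0 => /andP[_ /eqP y0].
    move/eqP: xy; rewrite y0 expr0n eqn0Ngt d_gt0 subr0 expf_eq0 (negbTE x0).
    by rewrite andbF.
  move/eqP: dp0; rewrite Ey mulr0 add0r mulf_eq0 subr_eq0 => /orP[/eqP xy|/eqP dEy].
    by case/eqP: Ex; rewrite (@split_pow _ _ _ _ _ QC (merged v) x y xy).
  exact: (sep y).
have [b pb] := exists_nonroot px0.
have prop := pencil_proportional xz b.
have pzb : (pencil v z).[b] != 0.
  apply: contraNneq pz0 => zb; move: prop; rewrite zb scale0r => /eqP.
  by rewrite scaler_eq0 (negbTE pb).
have sep_z : separated (line (upd v ord0 z) C).
  move=> y my; apply: (sep_px y).
  have [m0 m1] : multiple_root (pencil v z) y by rewrite /pencil mulrC; apply: multiple_root_mulr.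
  have e0 := congr1 (fun p : {poly K} => p.[y]) prop.
  have e1 := congr1 (fun p : {poly K} => p^`().[y]) prop.
  rewrite !hornerZ m0 mulr0 in e0; rewrite !derivZ !hornerZ m1 mulr0 in e1.
  split; apply/eqP.
    by move/esym/eqP: e0; rewrite mulf_eq0 (negbTE pzb).
  by move/esym/eqP: e1; rewrite mulf_eq0 (negbTE pzb).
pose v2 := upd (upd v ord0 x) j1 z.
have v20 : v2 ord0 = x by rewrite /v2 /upd.
have swap01 t : vext (upd v ord0 z) t \o tperm ord0 (@Ordinal r 1 isT) =1 vext v2 t.
  have w0 (w : 'I_n.+2 -> K) : vext w t ord0 = w ord0.
    by rewrite -(vext_widen w t); congr (vext w t _); apply: val_inj.
  have w1 (w : 'I_n.+2 -> K) : vext w t (@Ordinal r 1 isT) = w j1.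
    by rewrite -(vext_widen w t); congr (vext w t _); apply: val_inj.
  move=> i /=; case: tpermP => [->|->|i0 i1].
  - by rewrite w1 w0 v20 /upd.
  - by rewrite w0 w1 /v2 /upd eqxx.
  have [[k ek]|->] := widen_or_max i; last by rewrite !vext_max.
  rewrite ek !vext_widen /v2 /upd.
  case: eqP => [k0|_]; first by case: i0; rewrite ek k0; apply: val_inj.
  by case: eqP => [k1|//]; case: i1; rewrite ek k1; apply: val_inj.
have eL : line v2 C = line (upd v ord0 z) C.
  apply: poly_eq_horner => t; apply: (etrans (horner_line _ _ _)).
  apply: (etrans _ (esym (horner_line _ _ _))).
  apply: (etrans _ (C_perm QC (tperm ord0 (@Ordinal r 1 isT)) (vext (upd v ord0 z) t))).
  by apply: meval_eq => i; rewrite swap01.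
exists v2; split; last 2 first; try by rewrite eL.
rewrite v20.
have hz' : h.@[vext (merged v) z] = 0 by rewrite -hz; apply: esym; apply: horner_line.
have := factor_zero_tperm QC (@Ordinal r 1 isT) ord_max irr dh hz'.
move=> <-; apply: meval_eq => i /=.
have w1 (w : 'I_n.+2 -> K) t : vext w t (@Ordinal r 1 isT) = w j1.
  by rewrite -(vext_widen w t); congr (vext w t _); apply: val_inj.
case: tpermP => [->|->|i1 im].
- by rewrite w1 vext_max /v2 /upd eqxx.
- by rewrite w1 vext_max /merged /upd.
have [[k ek]|//] := widen_or_max i.
rewrite ek !vext_widen /v2 /merged /upd.
by case: eqP => [k1|//]; case: i1; rewrite ek k1; apply: val_inj.
Qed.

End GenericPoint.

(** * Two factors cannot coexist *)

Section TwoFactors.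
Variables (K : closedFieldType) (n d N : nat) (C : {mpoly K[n.+3]}).
Hypothesis QC : split_quotient d N C.
Hypothesis K0 : [pchar K] =i pred0.
Hypothesis d_gt0 : (0 < d)%N.

Local Notation r := n.+3.
Local Notation widen := (widen_ord (leqnSn n.+2)).
Implicit Types v : 'I_n.+2 -> K.

Let last_to0 (i : 'I_n.+2) : {mpoly K[r]} := if i == ord0 then 'X_ord_max else 'X_(widen i).

(* The resultant, in the last variable, of [p] and of [q] with its first variable
   renamed: it vanishes at [(x, w, y)] when [p x w t = 0 = q y w t] for some [t]. *)
Definition link (p q : {mpoly K[r]}) : {mpoly K[r]} :=
  resultant (map_poly (@mwiden n.+2 K) (muni p))
    (map_poly (mmap (@mpolyC r K) last_to0) (muni q)).

Let map_link1 v y p :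
  map_poly (meval (vext v y)) (map_poly (@mwiden n.+2 K) (muni p)) = line v p.
Proof.
rewrite /mwiden map_meval_mmap; apply/polyP => i; rewrite !coef_map /=.
by apply: meval_eq => k; rewrite mevalXU vext_widen.
Qed.

Let map_link2 v y q :
  map_poly (meval (vext v y)) (map_poly (mmap (@mpolyC r K) last_to0) (muni q)) =
  line (upd v ord0 y) q.
Proof.
rewrite map_meval_mmap; apply/polyP => i; rewrite !coef_map /=.
apply: meval_eq => k; rewrite /last_to0 /upd.
by case: eqP; rewrite mevalXU ?vext_max ?vext_widen.
Qed.

Let upd_same v : upd v ord0 (v ord0) =1 v.
Proof. by move=> i; rewrite /upd; case: eqP => // ->. Qed.

Let line_upd_same v p : line (upd v ord0 (v ord0)) p = line v p.
Proof.
by apply/polyP => i; rewrite !coef_map; apply: meval_eq; apply: upd_same.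
Qed.

Section Factorization.
Variables (p q : {mpoly K[r]}).
Hypothesis eC : C = p * q.

Let eC' : C = q * p. Proof. by rewrite mulrC. Qed.

Let size_link v : size (line v C) = size (muni C) ->
  [/\ size (line v p) = size (muni p), size (line v q) = size (muni q),
      size (map_poly (@mwiden n.+2 K) (muni p)) = size (muni p) &
      size (map_poly (mmap (@mpolyC r K) last_to0) (muni q)) = size (muni q)].
Proof.
move=> sC; have sp := size_line_factor QC eC sC; have sq := size_line_factor QC eC' sC.
split; [exact: sp|exact: sq| |].
  exact: (size_map_poly_comp (map_link1 v (v ord0) p) sp).
apply: (size_map_poly_comp (map_link2 v (v ord0) q)).
exact: (etrans (congr1 (fun x : {poly K} => size x) (line_upd_same v q)) sq).
Qed.

Lemma link_eq0 v y t : depends ord_max p -> depends ord_max q ->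
  (line v p).[t] = 0 -> (line (upd v ord0 y) q).[t] = 0 -> (link p q).@[vext v y] = 0.
Proof.
rewrite -!depends_max => sp sq pt qt.
have [v0 [_ _ _ _ [sC sm]]] := split_special QC.
have [_ _ s1 s2] := size_link (etrans sC (esym sm)).
apply: (@resultant_common_root _ _ (meval (vext v y)) _ _ t).
- exact: (leq_trans sp (eq_leq (esym s1))).
- exact: (leq_trans sq (eq_leq (esym s2))).
- exact: (etrans (congr1 (fun x : {poly K} => x.[t]) (map_link1 v y p)) pt).
exact: (etrans (congr1 (fun x : {poly K} => x.[t]) (map_link2 v y q)) qt).
Qed.

Lemma link_not_divides h : irreducible_elt h -> divides h C -> ~ divides h (link p q).
Proof.
move=> irr dh [g eg]; have [v [hv sep sC]] := factor_point QC K0 d_gt0 irr dh.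
have [sp sq s1 s2] := size_link sC.
have l0 : (link p q).@[vext v (v ord0)] = 0 by rewrite eg mevalM hv mul0r.
have e2 := etrans (map_link2 v (v ord0) q) (line_upd_same v q).
have e3 : line v p * line v q = line v C.
  exact: (esym (etrans (congr1 (line v) eC) (lineM v p q))).
move/eqP: l0; apply/negP.
apply: (resultant_specialize_neq0 (map_link1 v (v ord0) p) e2).
- exact: (etrans sp (esym s1)).
- exact: (etrans sq (esym s2)).
- by rewrite e3.
by rewrite e3 -size_poly_gt0 sC size_poly_gt0 muni_eq0 (C_neq0 QC).
Qed.

Lemma link_eliminant : exists2 c : {mpoly K[n.+2]}, c != 0 &
  forall v y, q.@[vext v y] = 0 -> (link p q).@[vext v y] = 0 -> c.@[v] = 0.
Proof.
have [h irr _ dq dl|c c0 Hc] := eliminant (p := muni q) (q := muni (link p q)) (mpoly_is_ufd K n.+2).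
  apply: (link_not_divides (irreducible_muni_inv irr) _ (divides_muni_inv dl)).
  by apply: (divides_trans (divides_muni_inv dq)); exists p.
exists c => // v y qy ly; apply: (Hc _ (meval v) y).
  by rewrite -[RHS]qy; apply: horner_line.
by rewrite -[RHS]ly; apply: horner_line.
Qed.

End Factorization.

Lemma factor_dependsW g : g != 0 -> g \isn't a GRing.unit -> divides g C ->
  depends ord_max g.
Proof.
move=> g0 nu dg; have [h [irr [k ek]]] := irreducible_factor (mpoly_is_ufd K r) g0 nu.
rewrite ek depends_mul -?ek //; apply/orP; left; apply: (factor_depends QC) => //.
by apply: divides_trans dg; exists k.
Qed.

Lemma no_factorization f g : (1 < N)%N -> irreducible_elt f -> g \isn't a GRing.unit ->
  C = f * g -> False.
Proof.
move=> N_gt1 irr nu eC; have eC' : C = g * f by rewrite mulrC.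
have C0 := C_neq0 QC.
have g0 : g != 0 by apply: contraNneq C0 => z; rewrite eC z mulr0.
have df : depends ord_max f by apply: (factor_depends QC) => //; exists g.
have dg : depends ord_max g by apply: factor_dependsW => //; exists f.
have mC0 : muni C != 0 by rewrite muni_eq0.
have [v0 [_ sep0 _ _ [sC sm]]] := split_special QC.
have [||B B0 HB] := generic_separated (p := muni C) (v0 := v0) mC0.
- exact: (etrans sC (esym sm)).
- exact: sep0.
have [c1 c10 H1] := link_eliminant eC; have [c2 c20 H2] := link_eliminant eC'.
have [v] := exists_nonzero (mulf_neq0 B0 (mulf_neq0 c10 c20)).
rewrite !mevalM !mulf_eq0 !negb_or => /and3P[Bv c1v c2v].
have [sv sepv] : size (line v C) = size (muni C) /\ separated (line v C) := HB v Bv.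
have L0 : line v C != 0 by rewrite -size_poly_gt0 sv size_poly_gt0.
have [t ft] : exists t, (line v f).[t] = 0.
  by apply: exists_root; rewrite (size_line_factor QC eC sv) depends_max.
have [y gy] : exists y, (line v g).[y] = 0.
  by apply: exists_root; rewrite (size_line_factor QC eC' sv) depends_max.
have [t' [y' [ft' gy' ty]]] : exists t y, [/\ (line v f).[t] = 0, (line v g).[y] = 0 &
    t ^+ d != y ^+ d].
  apply: NNPP => no.
  have all_eq t' y' : (line v f).[t'] = 0 -> (line v g).[y'] = 0 -> t' ^+ d = y' ^+ d.
    by move=> a b; apply/eqP; apply: contraT => c; case: no; exists t', y'.
  have : line v C %| 'X^d - (t ^+ d)%:P.
    apply: separated_divp => // x; rewrite eC lineM.
    rewrite hornerM => /eqP; rewrite mulf_eq0 hornerD hornerN hornerXn hornerC.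
    case/orP => /eqP xr; last by rewrite (all_eq t x) // subrr.
    by rewrite (all_eq x y) // (all_eq t y) // subrr.
  move/dvdp_leq; rewrite -size_poly_eq0 size_XnsubC // => /(_ isT).
  by rewrite sv sm ltnS -{2}(muln1 d) leq_pmul2l // leqNgt N_gt1.
have root_pencil s : (line v C).[s] = 0 -> (pencil d C v (v ord0)).[s] = 0.
  by move=> ls; rewrite horner_pencil line_upd_same ls mulr0.
have pt : (pencil d C v (v ord0)).[t'] = 0.
  by apply: root_pencil; rewrite eC; apply: line_mul_root.
have py : (pencil d C v (v ord0)).[y'] = 0.
  by apply: root_pencil; rewrite eC'; apply: line_mul_root.
have pyt : (pencil d C v y').[t'] = 0.
  have p0 : pencil d C v (v ord0) != 0.
    by rewrite -size_poly_gt0 (size_pencil d_gt0) line_upd_same // addn_gt0 d_gt0.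
  have [x px] := exists_nonroot p0.
  have := pencil_plucker QC v (v ord0) y' t' x.
  by rewrite pt py !mul0r subrr add0r => /eqP; rewrite mulf_eq0 (negbTE px) => /eqP.
have Cyt : (line (upd v ord0 y') C).[t'] = 0.
  move/eqP: pyt; rewrite horner_pencil mulf_eq0 subr_eq0 eq_sym (negbTE ty).
  by move/eqP.
move: Cyt; rewrite eC lineM hornerM => /eqP; rewrite mulf_eq0 => /orP[/eqP fyt|/eqP gyt].
  case/eqP: c2v; apply: (H2 v t').
    by rewrite -[RHS]ft'; apply: esym; apply: horner_line.
  apply: (link_eq0 eC' dg df gy').
  have := factor_zero_tperm QC ord0 ord_max irr (ex_intro _ g eC) (etrans (esym (horner_line _ _ _)) fyt).
  move=> <-; apply: (etrans (horner_line _ _ _)); apply: meval_eq => i.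
  by rewrite vext_upd_swap.
case/eqP: c1v; apply: (H1 v y').
  by rewrite -[RHS]gy'; apply: esym; apply: horner_line.
exact: (link_eq0 eC df dg ft' gyt).
Qed.

End TwoFactors.

(** * Quotients of degree one in each variable *)

Section Eisenstein.
Variables (K : closedFieldType) (d : nat).
Hypothesis d_gt0 : (0 < d)%N.
Implicit Types (P Q : {poly K}) (F G : {poly {poly K}}).

Let ev (x : K) : {poly {poly K}} -> {poly K} := map_poly (horner_eval x).

Let coef0_pencil P Q : (P *: 'X^d + Q%:P : {poly {poly K}})`_0 = Q.
Proof. by rewrite coefD coefZ coefXn coefC eq_sym eqn0Ngt d_gt0 mulr0 add0r. Qed.

Lemma size_binomial P Q : P != 0 -> size (P *: 'X^d + Q%:P : {poly {poly K}}) = d.+1.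
Proof.
by move=> P0; rewrite size_polyDl size_scale ?size_polyXn // ltnS (leq_trans (size_polyC_leq1 _)).
Qed.

Let lead_pencil P Q : P != 0 -> lead_coef (P *: 'X^d + Q%:P : {poly {poly K}}) = P.
Proof.
move=> P0; rewrite lead_coefDl ?lead_coefZ ?lead_coefXn ?mulr1 //.
by rewrite size_scale // size_polyXn ltnS (leq_trans (size_polyC_leq1 _)).
Qed.

Let deriv_mul0 P Q x : P.[x] = 0 -> Q.[x] = 0 -> (P * Q)^`().[x] = 0.
Proof. by move=> px qx; rewrite derivM hornerD !hornerM px qx mul0r mulr0 addr0. Qed.

(* Eisenstein's criterion at the prime [T - x] of [K[T]], for the constant and then for
   the leading coefficient. *)
Lemma eisenstein_low P Q F G x : F * G = P *: 'X^d + Q%:P ->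
  (1 < size F)%N -> (1 < size G)%N -> P.[x] != 0 -> Q.[x] = 0 -> Q^`().[x] = 0.
Proof.
move=> e sF sG Px Qx.
have P0 : P != 0 by apply: contraNneq Px => ->; rewrite horner0.
have c0 : P *: 'X^d + Q%:P != 0 :> {poly {poly K}}.
  by rewrite -size_poly_eq0 size_binomial.
have ec : ev x (P *: 'X^d + Q%:P) = P.[x] *: 'X^d.
  by rewrite /ev rmorphD /= map_polyZ map_polyXn map_polyC /= /horner_eval Qx addr0.
have sc : size (ev x (P *: 'X^d + Q%:P)) = size (P *: 'X^d + Q%:P : {poly {poly K}}).
  by rewrite size_binomial // ec size_scale // size_polyXn.
have vanish (A B : {poly {poly K}}) :
    A * B = P *: 'X^d + Q%:P -> (1 < size A)%N -> (A`_0).[x] = 0.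
  move=> eAB sA.
  have sA' : size (ev x A) = size A by apply: (size_map_factor (esym eAB) c0 sc).
  have [y Ay] : exists y, (ev x A).[y] = 0 by apply: exists_root; rewrite sA'.
  have y0 : y = 0.
    have : (ev x (P *: 'X^d + Q%:P)).[y] = 0 by rewrite -eAB /ev rmorphM hornerM -/(ev x A) Ay mul0r.
    rewrite ec hornerZ hornerXn => /eqP; rewrite mulf_eq0 (negbTE Px) expf_eq0.
    by move=> /andP[_ /eqP].
  by rewrite -[RHS]Ay y0 horner_coef0 coef_map.
have eQ : Q = F`_0 * G`_0 by rewrite -(coef0_pencil P Q) -e coef0M.
rewrite eQ; apply: deriv_mul0; first exact: vanish e sF.
by apply: (vanish G F) => //; rewrite mulrC.
Qed.

Lemma eisenstein_high P Q F G x : F * G = P *: 'X^d + Q%:P -> P != 0 ->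
  (1 < size F)%N -> (1 < size G)%N -> Q.[x] != 0 -> P.[x] = 0 -> P^`().[x] = 0.
Proof.
move=> e P0 sF sG Qx Px.
have ec : ev x F * ev x G = Q.[x]%:P.
  rewrite -rmorphM e rmorphD /= map_polyZ map_polyXn map_polyC /= /horner_eval.
  by rewrite Px scale0r add0r.
have vanish (A B : {poly {poly K}}) :
    ev x A * ev x B = Q.[x]%:P -> (1 < size A)%N -> (lead_coef A).[x] = 0.
  move=> eAB sA; apply/eqP; apply: contraTT sA => lA; rewrite -leqNgt.
  have <- : size (ev x A) = size A by apply: size_map_poly_id0.
  have A0 : ev x A != 0.
    by apply: contraNneq Qx => z; rewrite -(hornerC Q.[x] 0) -eAB z mul0r horner0.
  have B0 : ev x B != 0.
    by apply: contraNneq Qx => z; rewrite -(hornerC Q.[x] 0) -eAB z mulr0 horner0.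
  have := size_polyC Q.[x]; rewrite -eAB size_mul // Qx.
  rewrite -size_poly_gt0 in A0; rewrite -size_poly_gt0 in B0.
  by move: (size _) (size _) A0 B0 => a b; lia.
have eP : P = lead_coef F * lead_coef G by rewrite -(lead_pencil Q P0) -e lead_coefM.
rewrite eP; apply: deriv_mul0; first exact: vanish ec sF.
by apply: (vanish G F) => //; rewrite mulrC.
Qed.

Hypothesis K0 : [pchar K] =i pred0.

Let simple_root (a b : K) : a != 0 -> b != 0 -> exists x,
  [/\ (a *: 'X^d + b%:P).[x] = 0, (a *: 'X^d + b%:P)^`().[x] != 0 & a * x ^+ d = - b].
Proof.
move=> a0 b0; have [|x xr] := @exists_root K (a *: 'X^d + b%:P).
  by rewrite size_polyDl size_scale ?size_polyXn ?ltnS // (leq_trans (size_polyC_leq1 _)).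
have ax : a * x ^+ d = - b.
  by apply/eqP; rewrite -addr_eq0 -[X in _ == X]xr hornerD hornerZ hornerXn hornerC.
exists x; split=> //; rewrite derivD derivC addr0 derivZ derivXn hornerZ hornerMn hornerXn.
rewrite mulf_neq0 // -mulr_natr mulf_neq0 ?natK_neq0 // expf_neq0 //.
apply: contraNneq b0 => x0; move/eqP: ax; rewrite x0 expr0n eqn0Ngt d_gt0 mulr0.
by rewrite eq_sym oppr_eq0.
Qed.

Lemma biquadratic_irreducible (p q t : K) F G :
  F * G = (p *: 'X^d + q%:P) *: 'X^d + (q *: 'X^d + t%:P)%:P ->
  q != 0 -> p * t != q ^+ 2 -> (t != 0) || (p != 0) ->
  (1 < size F)%N -> (1 < size G)%N -> False.
Proof.
move=> e q0 ptq tp sF sG.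
have [t0|t0] := eqVneq t 0.
  have p0 : p != 0 by rewrite t0 eqxx in tp.
  have [x [x1 x2 x3]] := simple_root p0 q0.
  case/eqP: x2; apply: (eisenstein_high e) => //.
    by apply: contraNneq q0 => z; have := congr1 (fun u : {poly K} => u`_0) z;
      rewrite coefD coefZ coefXn coefC eq_sym eqn0Ngt d_gt0 mulr0 add0r coef0 => ->.
  rewrite hornerD hornerZ hornerXn hornerC t0 addr0 mulf_neq0 //.
  by apply: contraNneq q0 => z; move/eqP: x3; rewrite z mulr0 eq_sym oppr_eq0.
have [x [x1 x2 x3]] := simple_root q0 t0.
case/eqP: x2; apply: (eisenstein_low e) => //.
apply: contraNneq ptq; rewrite hornerD hornerZ hornerXn hornerC => z.
have : q * (p * x ^+ d + q) = 0 by rewrite z mulr0.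
by rewrite mulrDr mulrCA x3 mulrN expr2 addrC => /eqP; rewrite subr_eq0 => /eqP ->.
Qed.

End Eisenstein.

Lemma coef_XaddC1_exp (R : comNzRingType) M k : (('X + 1 : {poly R}) ^+ M)`_k = 'C(M, k)%:R.
Proof.
elim: M k => [|M IH] k; first by rewrite expr0 coef1; case: k.
rewrite exprS mulrDl mul1r coefD coefXM; case: k => [|k] /=; rewrite !IH.
  by rewrite !bin0 add0r.
by rewrite binS natrD addrC.
Qed.

Lemma bin_log_concave M k : (k < M)%N -> ('C(M, k) * 'C(M, k.+2) <> 'C(M, k.+1) ^ 2)%N.
Proof.
move=> kM e; have := mul_bin_left M k; have := mul_bin_left M k.+1.
have b1 : (0 < 'C(M, k.+1))%N by rewrite bin_gt0.
move=> e1 e2; have : ((M - k) * k.+2 * ('C(M, k) * 'C(M, k.+2)) =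
    k.+1 * (M - k.+1) * 'C(M, k.+1) ^ 2)%N.
  transitivity ((k.+1 * 'C(M, k.+1)) * (k.+2 * 'C(M, k.+2)))%N; first by rewrite e2; lia.
  by rewrite e1; lia.
rewrite e => /eqP; rewrite eqn_pmul2r ?expn_gt0 ?b1 // => /eqP.
have -> : (M - k = (M - k.+1).+1)%N by lia.
by move: (M - k.+1)%N => a; nia.
Qed.

Section MissingExponent.
Variables (R : comNzRingType) (k : nat) (e : 'I_k.+1 -> nat).
Implicit Types v : 'I_k.+1 -> R.

Lemma alt_col0 v l : alt (upd e ord0 l) v =
  \sum_i v i ^+ l * cofactor (\matrix_(i, j) v i ^+ e j) i ord0.
Proof.
rewrite /alt (expand_det_col _ ord0); apply: eq_bigr => i _.
rewrite !mxE /upd eqxx; congr (_ * (_ * \det _)).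
by apply/matrixP => a b; rewrite !mxE /upd eq_sym (negbTE (neq_lift _ _)).
Qed.

(* [\prod_i (X - v i)] vanishes at the [v i], which rewrites their powers [k.+1]. *)
Lemma alt_top_exponent v : e ord0 = k.+1 ->
  alt e v = - \sum_(l < k.+1) (\prod_i ('X - (v i)%:P))`_l * alt (upd e ord0 l) v.
Proof.
move=> e0; set chi := \prod_i _.
have mchi : chi \is monic by apply: monic_prod_XsubC.
have schi : size chi = k.+2.
  by rewrite /chi size_prod_XsubC /index_enum -enumT size_enum_ord.
have top i : v i ^+ k.+1 = - \sum_(l < k.+1) chi`_l * v i ^+ l.
  have : chi.[v i] = 0.
    by rewrite /chi horner_prod (bigD1 i) //= hornerXsubC subrr mul0r.
  rewrite horner_coef schi big_ord_recr /=.
  have -> : chi`_k.+1 = 1 by move/monicP: mchi; rewrite lead_coefE schi.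
  by rewrite mul1r addrC => /eqP; rewrite addr_eq0 => /eqP.
rewrite -(eq_alt (e := upd e ord0 k.+1) (v := v)) //; last first.
  by move=> j; rewrite /upd; case: eqP => // ->.
rewrite alt_col0 (eq_bigr (fun i => - \sum_(l < k.+1) chi`_l *
   (v i ^+ l * cofactor (\matrix_(i, j) v i ^+ e j) i ord0))); last first.
  move=> i _; rewrite top mulNr mulr_suml; congr (- _); apply: eq_bigr => l' _; exact: esym (mulrA _ _ _).
rewrite sumrN exchange_big; congr (- _); apply: eq_bigr => l _.
by rewrite alt_col0 mulr_sumr.
Qed.

Lemma alt_repeat_exp f v i j : i != j -> f i = f j -> alt f v = 0 :> R.
Proof.
move=> ij fij; rewrite /alt -det_tr; apply: (determinant_alternate ij) => l.
by rewrite !mxE fij.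
Qed.

End MissingExponent.

Lemma quotient_missing (K : fieldType) (k : nat) (e : 'I_k.+1 -> nat) (C : {mpoly K[k.+1]}) :
  (forall i j : 'I_k.+1, (i < j)%N -> (e j < e i)%N) -> e ord_max = 0%N ->
  e ord0 = k.+1 -> is_quotient e C ->
  exists m, [/\ (0 < m)%N, (m <= k)%N & exists2 s : K, s != 0 & forall u,
    C.@[u] = s * (\prod_i ('X - (u i)%:P))`_m].
Proof.
move=> e_decr e_max e0 HC.
have le_e j : (e j < k.+2)%N.
  rewrite -e0 ltnS; have [->//|j0] := eqVneq j ord0; apply/ltnW/e_decr.
  by rewrite lt0n -val_eqE in j0 *.
have e_inj := decreasing_inj e_decr.
have [m nm] : exists m : 'I_k.+2, forall j, e j != m.
  apply: NNPP => no.
  have surj (m : 'I_k.+2) : exists j, e j = m.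
    by apply: NNPP => H; apply: no; exists m => j; apply/eqP => ej; apply: H; exists j.
  have [g gE] := fin_all_exists surj.
  have gi : injective g by move=> a b ab; apply: val_inj; rewrite /= -!gE ab.
  by have := leq_card g gi; rewrite !card_ord ltnn.
have m0 : (0 < m)%N by rewrite lt0n eq_sym -e_max.
have mk : (m <= k)%N.
  by rewrite -ltnS ltn_neqAle eq_sym -{1}e0 nm -ltnS ltn_ord.
pose f := upd e ord0 m.
have f_le j : (f j <= k)%N.
  rewrite /f /upd; case: eqP => // /eqP j0; rewrite -ltnS -e0; apply: e_decr.
  by rewrite lt0n -val_eqE in j0 *.
have f_inj : injective f.
  move=> i j; rewrite /f /upd; case: eqP => [->|_]; case: eqP => [->|_] // eij.
  - by have := nm j; rewrite -eij eqxx.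
  - by have := nm i; rewrite eij eqxx.
  exact: e_inj.
have s_inj : injective (fun j => inord (k - f j) : 'I_k.+1).
  move=> i j /(congr1 (@nat_of_ord _)); rewrite !inordK ?ltnS ?leq_subr // => E.
  by apply: f_inj; move: (f_le i) (f_le j) E; lia.
have fE : f =1 @rho k.+1 \o perm s_inj.
  by move=> j; rewrite /rho /= permE inordK ?ltnS ?leq_subr // subKn.
exists m; split=> //.
pose chi : {poly {mpoly K[k.+1]}} := \prod_i ('X - ('X_i)%:P).
have eC : C = - (-1) ^+ perm s_inj * chi`_m.
  apply: (mulfI (alt_rho_neq0 (@mpolyX_inj K k.+1))); rewrite -HC alt_top_exponent // -/chi; move: chi => chi.
  have lt_m : (m < k.+1)%N by [].
  rewrite (bigD1 (Ordinal lt_m)) //= big1 ?addr0 => [|l lm]; last first.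
    pose j := ((perm s_inj)^-1)%g (inord (k - l)).
    have fj : f j = l.
      by rewrite fE /rho /j /= permKV inordK ?ltnS ?leq_subr // subKn // -ltnS.
    have j0 : j != ord0.
      by apply/eqP => jE; case/eqP: lm; apply: val_inj; rewrite /= -fj jE /f /upd eqxx.
    rewrite (@alt_repeat_exp _ _ _ _ ord0 j) ?mulr0 1?eq_sym // /upd eqxx (negbTE j0).
    by rewrite -fj /f /upd (negbTE j0).
  rewrite -/f (eq_alt fE (fun=> erefl)) alt_perm_exp mulNr mulrN; congr (- _).
  by rewrite mulrA mulrC [_`_m * _]mulrC.
exists (- (-1) ^+ perm s_inj); first by rewrite oppr_eq0 signr_eq0.
move=> u; rewrite eC mevalM rmorphN rmorphXn /= mevalN meval1; congr (_ * _).
have -> : \prod_i ('X - (u i)%:P) = map_poly (meval u) chi.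
  rewrite /chi rmorph_prod; apply: eq_bigr => i _.
  by rewrite rmorphB /= map_polyX map_polyC /= mevalXU.
by rewrite coef_map.
Qed.

Lemma eqr_nat_pchar0 (K : idomainType) (a b : nat) : [pchar K] =i pred0 ->
  (a%:R == b%:R :> K) = (a == b).
Proof.
move=> K0; wlog le_ab : a b / (a <= b)%N => [H|].
  by case: (leqP a b) => [/H//|/ltnW/H]; rewrite eq_sym [RHS]eq_sym.
have /pcharf0P K0' := K0; rewrite -subr_eq0 -opprB oppr_eq0 -natrB // K0' subn_eq0.
by rewrite [RHS]eqn_leq le_ab.
Qed.

Lemma coef_mul_two_roots (R : comNzRingType) (q : {poly R}) a b m :
  (('X - a%:P) * q * ('X - b%:P))`_m.+1 =
  (q`_m.+1 * a - q`_m) * b + ((if m is l.+1 then q`_l else 0) - q`_m * a).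
Proof.
rewrite mulrBr coefB coefMX coefMC !mulrBl !coefB !coefXM !coefCM /=.
by case: m => [|m] /=; ring.
Qed.

Section DegreeOne.
Variables (K : closedFieldType) (n d m : nat) (C : {mpoly K[n.+3]}) (s : K).
Hypothesis K0 : [pchar K] =i pred0.
Hypothesis d_gt0 : (0 < d)%N.
Hypothesis QC : split_quotient d 1 C.
Hypotheses (m_gt0 : (0 < m)%N) (m_le : (m <= n.+2)%N) (s0 : s != 0).
Hypothesis CE : forall u, C.@[u] = s * (\prod_i ('X - (u i ^+ d)%:P))`_m.

Let b k : K := 'C(n.+1, k)%:R.

Let plane (w : K) : {mpoly K[n.+2]} -> {poly K} :=
  mmap (@polyC K) (fun i => if i == ord0 then 'X else w%:P).

HB.instance Definition _ w :=
  GRing.RMorphism.copy (plane w) (mmap (@polyC K) (fun i => if i == ord0 then 'X else w%:P)).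

Let horner_plane w x p : (plane w p).[x] = p.@[upd (fun=> w) ord0 x].
Proof.
apply: (@mpoly_hom_ext _ _ _ (horner_eval x \o plane w)
  (meval (upd (fun=> w) ord0 x))) => [c|i] /=.
  by rewrite /plane mmapC mevalC /horner_eval hornerC.
rewrite /plane mmapX mmap1U mevalXU /upd /horner_eval; case: eqP => _.
  by rewrite hornerX.
by rewrite hornerC.
Qed.

Let eval_plane w x y : w ^+ d = -1 -> C.@[vext (upd (fun=> w) ord0 x) y] =
  s * ((b m * x ^+ d - b m.-1) * y ^+ d + ((if m is l.+2 then b l else 0) - b m.-1 * x ^+ d)).
Proof.
move=> wd; rewrite CE big_ord_recr big_ord_recl /=.
rewrite vext_max (eq_bigr (fun=> 'X + 1)) => [|i _]; last first.
  by rewrite vext_widen /upd /= wd rmorphN opprK.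
rewrite vext_widen /upd eqxx prodr_const card_ord -(prednK m_gt0) coef_mul_two_roots /=.
by case: m.-1 => [|l]; rewrite !coef_XaddC1_exp.
Qed.

Let plane_muni w : w ^+ d = -1 -> map_poly (plane w) (muni C) =
  ((s * b m) *: 'X^d + (- (s * b m.-1))%:P) *: 'X^d +
  ((- (s * b m.-1)) *: 'X^d + (s * if m is l.+2 then b l else 0)%:P)%:P.
Proof.
move=> wd; apply/polyP => i; apply: poly_eq_horner => x.
have -> : ((map_poly (plane w) (muni C))`_i).[x] = (line (upd (fun=> w) ord0 x) C)`_i.
  by rewrite !coef_map; apply: horner_plane.
move: i x; suff H x : line (upd (fun=> w) ord0 x) C = map_poly (horner_eval x)
    (((s * b m) *: 'X^d + (- (s * b m.-1))%:P) *: 'X^d +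
  ((- (s * b m.-1)) *: 'X^d + (s * if m is l.+2 then b l else 0)%:P)%:P).
  by move=> i x; rewrite H coef_map.
apply: poly_eq_horner => y; rewrite horner_line eval_plane //.
rewrite rmorphD /= map_polyZ map_polyXn map_polyC /= /horner_eval.
rewrite !(hornerD, hornerZ, hornerXn, hornerC).
by move: (if m is l.+2 then _ else _) => t; ring.
Qed.

Lemma no_factorization_degree_one f g : irreducible_elt f -> g \isn't a GRing.unit ->
  C = f * g -> False.
Proof.
move=> irr nu eC; have C0 := C_neq0 QC.
have g0 : g != 0 by apply: contraNneq C0 => z; rewrite eC z mulr0.
have df : depends ord_max f by apply: (factor_depends QC) => //; exists g.
have dg : depends ord_max g by apply: (factor_dependsW QC) => //; exists f; rewrite mulrC.
have [w [wd _]] := nth_root_exists d_gt0 (-1 : K).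
have e := plane_muni wd.
have bn0 k : (k <= n.+1)%N -> b k != 0 by move=> le; rewrite natK_neq0 // bin_gt0.
have bm : b m.-1 != 0 by apply: bn0; lia.
have [v0 [_ _ _ _ [_ sm]]] := split_special QC.
have P0 : (s * b m) *: 'X^d + (- (s * b m.-1))%:P != 0.
  apply: contraNneq bm => /(congr1 (fun p : {poly K} => p`_0)).
  rewrite coefD coefZ coefXn coefC eq_sym eqn0Ngt d_gt0 mulr0 add0r coef0.
  by move/eqP; rewrite oppr_eq0 mulf_eq0 (negbTE s0).
have mC0 : muni C != 0 by rewrite muni_eq0.
have sC : size (map_poly (plane w) (muni C)) = size (muni C).
  by rewrite sm muln1 e size_binomial.
have eF : map_poly (plane w) (muni f) * map_poly (plane w) (muni g) =
    map_poly (plane w) (muni C) by rewrite eC !rmorphM.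
have sf : size (map_poly (plane w) (muni f)) = size (muni f).
  by apply: (@size_map_factor _ _ _ _ _ (muni g) _ mC0 sC); rewrite eC rmorphM.
have sg : size (map_poly (plane w) (muni g)) = size (muni g).
  by apply: (@size_map_factor _ _ _ _ _ (muni f) _ mC0 sC); rewrite eC [f * g]mulrC rmorphM.
have df' : (1 < size (map_poly (plane w) (muni f)))%N by rewrite sf depends_max.
have dg' : (1 < size (map_poly (plane w) (muni g)))%N by rewrite sg depends_max.
apply: (biquadratic_irreducible d_gt0 K0 (etrans eF e) _ _ _ df' dg').
- by rewrite oppr_eq0 mulf_neq0.
- rewrite sqrrN exprMn mulrACA -expr2 (inj_eq (mulfI (expf_neq0 2 s0))).
  case: m m_le m_gt0 bm => [|[|k]] // mk _ /= bm'; first by rewrite mulr0 eq_sym expf_neq0.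
  rewrite -natrM -natrX (eqr_nat_pchar0 _ _ K0).
  by apply/eqP => E; apply: (@bin_log_concave n.+1 k); [lia|rewrite mulnC].
rewrite !mulf_eq0 (negbTE s0) /=; case: m m_le m_gt0 => [|[|k]] // mk _ /=.
  by rewrite eqxx /=; apply: bn0.
by rewrite bn0 //; lia.
Qed.

End DegreeOne.

Lemma quotient_irreducible (K : closedFieldType) (n d : nat) (e : 'I_n.+3 -> nat)
    (C1 : {mpoly K[n.+3]}) : [pchar K] =i pred0 -> (0 < d)%N ->
  (forall i j : 'I_n.+3, (i < j)%N -> (e j < e i)%N) -> e ord_max = 0%N ->
  \big[gcdn/0%N]_i e i = 1%N -> (n.+2 < e ord0)%N -> is_quotient e C1 ->
  irreducible_elt (pow_vars d C1).
Proof.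
move=> K0 d_gt0 e_decr e_max e_gcd e_big HC; set C := pow_vars d C1.
have QC : split_quotient d (e ord0 - n.+2) C.
  split; [exact: pow_quotient_sym HC|exact: pow_quotient_plucker HC| |exact: horner_line_pow|].
    by move=> t u; apply: (pow_quotient_scale HC).
  exact: special_line HC K0 d_gt0 e_decr e_max e_gcd e_big.
have C0 := C_neq0 QC; split.
  have [_ [_ _ _ _ [_ sm]]] := split_special QC.
  apply/negP => /mpoly_unitP [c c0 cE]; move: sm; rewrite cE muniC => /eqP.
  by rewrite size_polyC; case: (_ != 0); nia.
move=> [f [g [nf ng eC]]].
have f0 : f != 0 by apply: contraNneq C0 => z; rewrite eC z mul0r.
have [h [irr [k ek]]] := irreducible_factor (mpoly_is_ufd K n.+3) f0 nf.
have eC' : C = h * (k * g) by rewrite eC ek mulrA.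
have nkg : k * g \isn't a GRing.unit by rewrite unitrM negb_and ng orbT.
have [N1|N1] := leqP (e ord0) n.+3; last first.
  by apply: (no_factorization QC K0 d_gt0 _ irr nkg eC'); lia.
have e0 : e ord0 = n.+3 by lia.
have [m [m0 m_le [s s0 sE]]] := quotient_missing e_decr e_max e0 HC.
rewrite e0 subSnn in QC.
apply: (no_factorization_degree_one K0 d_gt0 QC m0 m_le s0 _ irr nkg eC') => u.
by rewrite meval_pow_vars sE.
Qed.

Lemma decreasing_gap (n : nat) (e : 'I_n.+1 -> nat) :
  (forall i j : 'I_n.+1, (i < j)%N -> (e j < e i)%N) ->
  forall i j : 'I_n.+1, (i <= j)%N -> (e j + (j - i) <= e i)%N.
Proof.
move=> e_decr i [m m_lt] /=; elim: m m_lt => [|m IH] m_lt le_im.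
  have -> : i = Ordinal m_lt by apply: val_inj; move: le_im; rewrite /= leqn0 => /eqP.
  by rewrite /= subnn addn0.
have [im|im] := eqVneq (val i) m.+1.
  have -> : i = Ordinal m_lt by apply: val_inj.
  by rewrite /= subnn addn0.
have lt_im : (i <= m)%N by move: im; rewrite /= in le_im *; lia.
have := IH (ltnW m_lt) lt_im.
have := e_decr (Ordinal (ltnW m_lt)) (Ordinal m_lt) (ltnSn m).
by lia.
Qed.

Theorem theorem1p2 (r : nat) (lam : 'I_r -> nat) :
  (2 <= r)%N ->
  (forall i j : 'I_r, (i < j)%N -> (lam j < lam i)%N) ->
  (forall j : 'I_r, val j = r.-1 -> lam j = 0%N) ->
  lam <> drho (dlam lam) ->
  exists C : {mpoly CC[r]},
    Sdet lam = Sdet (drho (dlam lam)) * C /\ irreducible_elt C.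
Proof.
case: r lam => [|[|n]] lam // _ lam_decr lam_last lam_drho.
set d := dlam lam in lam_drho *.
have lam_max : lam ord_max = 0%N by apply: lam_last.
have lam0 : (0 < lam ord0)%N by rewrite -lam_max; apply: lam_decr.
have d_dvd j : (d %| lam j)%N by rewrite /d /dlam; apply: (biggcdn_inf j).
have d_gt0 : (0 < d)%N by apply: (dvdn_gt0 lam0); apply: d_dvd.
pose e j := (lam j %/ d)%N.
have lamE j : lam j = (d * e j)%N by rewrite mulnC divnK.
have e_decr (i j : 'I_n.+2) : (i < j)%N -> (e j < e i)%N.
  by move=> /lam_decr; rewrite !lamE ltn_pmul2l.
have e_max : e ord_max = 0%N by rewrite /e lam_max div0n.
have e_gcd : \big[gcdn/0%N]_i e i = 1%N.
  apply/eqP; rewrite -(eqn_pmul2l d_gt0) muln1.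
  rewrite (big_morph (muln d) (muln_gcdr d) (muln0 d)).
  by rewrite -(eq_bigr _ (fun j _ => lamE j)) eqxx.
have e_big : (n.+1 < e ord0)%N.
  rewrite ltnNge; apply/negP => e0; apply: lam_drho.
  apply: functional_extensionality => j; rewrite lamE /drho; congr (_ * _)%N.
  have /= := decreasing_gap e_decr (leq0n j : (@ord0 n.+1 <= j)%N).
  have /= := decreasing_gap e_decr (leq_ord j : (j <= @ord_max n.+1)%N).
  by rewrite e_max; move: (leq_ord j); lia.
case: n lam d @e lam_decr lam_last lam_drho lam_max lam0 d_dvd d_gt0 lamE e_decr e_max e_gcd e_big
    => [|n] lam d e _ _ _ _ _ _ d_gt0 lamE e_decr e_max e_gcd e_big.
  move: e_gcd; rewrite big_ord_recl big_ord1.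
  have -> : lift ord0 ord0 = ord_max :> 'I_2 by apply: val_inj.
  by rewrite e_max gcdn0 => e1; rewrite e1 in e_big.
have [C1 HC] := alt_quotient e (fun i : 'I_n.+3 => 'X_i : {mpoly CC[n.+3]}).
exists (pow_vars d C1); split; last first.
  exact: (quotient_irreducible (Num.Theory.pchar_num _) d_gt0 e_decr e_max e_gcd e_big HC).
have := quotient_hom HC (@mpolyC n.+3 CC) (fun i => 'X_i ^+ d); rewrite !alt_pow => H.
rewrite -[Sdet lam]/(alt lam (fun i => 'X_i)) (eq_alt lamE (fun=> erefl)).
exact: H.
Qed.
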